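(* Let $G$ be a discrete free Fuchsian group of rank two with invariant disc $\Delta$, without parabolic elements, whose generators have intersecting axes; let $A,B$ be stopping generators and let $H=\mathbb H^3/G$. For each $s>0$, the surface $$\mathcal S(s)=N_{ext}(s)\cup N_{int}(s)\cup F_{[B,A]}(s)\subset H$$ is invariant under the hyperelliptic isometry $j:H\to H$.
   Context: $\mathbb H^3$ is upper half-space with boundary $\hat{\mathbb C}$; $\Delta=\{|z|<1\}$; $\mathbb P\subset\mathbb H^3$ is the hyperbolic plane with boundary $\partial\Delta$. $G$ acts on $\mathbb H^3$ preserving $\mathbb P$ and each of its two sides (the exterior side faces $\{|z|>1\}$, the interior side faces $\Delta$). $[X,Y]=XYX^{-1}Y^{-1}$. $Ax_W$ denotes the axis of $W\in G$; it lies in $\mathbb P$. For $x\in\mathbb P$, $V_x(t)$, $t\in\mathbb R$, is the arclength-parameterized line orthogonal to $\mathbb P$ with $V_x(0)=x$, directed so that $t>0$ is on the exterior side, and $H_x$ is the half-turn about this line. Stopping generators (intersecting axes): for generators $A,B$ with intersecting axes let $p=Ax_A\cap Ax_B$ and let $p_A,p_B\in\mathbb P$ be the points with $A=H_pH_{p_A}$, $B=H_pH_{p_B}$. The pair is stopping if the distances between $p,p_A,p_B$ are minimal among all Nielsen equivalent pairs of generators, i.e. $d(p,p_A)\le d(p,p_B)\le d(p_A,p_B)$ and the traces of $A,B$ (in absolute value) are minimal among all pairs of generators of $G$. The involution $j$: $G$ is a normal subgroup of index two in $\langle H_p,H_{p_A},H_{p_B}\rangle$, and $H_p,H_{p_A},H_{p_B}$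 differ by elements of $G$; $j:H\to H$ is the order two isometry they all induce. The surface $\mathcal S(s)$: $\mathcal C\subset\mathbb P$ is the hyperbolic convex hull in $\mathbb H^3$ of the limit set of $G$. Put $\Pi(\pm s)=\{V_x(\pm s):x\in\mathbb P\}$, $N_{ext}(s)=\{V_x(s):x\in\mathcal C\}/G$, $N_{int}(s)=\{V_x(-s):x\in\mathcal C\}/G$. Let $Eq_{[B,A]}(s)$ be the set of points at distance $s$ from $Ax_{[B,A]}$ (a boundary line of $\mathcal C$ in $\mathbb P$; all boundary lines are its $G$-translates). The curves $Eq_{[B,A]}(s)\cap\Pi(\pm s)$ divide it into two strips, exactly one of which is disjoint from $\mathcal C$; call it $Rec_{[B,A]}(s)$. The funnel $F_{[B,A]}(s)$ is the image of $Rec_{[B,A]}(s)$ in $H$. *)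

(* Defs.v *)
From HB Require Import structures.
From mathcomp Require Import all_boot all_order all_algebra.
From mathcomp Require Import complex.
From mathcomp Require Import all_classical all_reals all_analysis.

Set Implicit Arguments.
Unset Strict Implicit.
Unset Printing Implicit Defensive.

Import Order.TTheory GRing.Theory Num.Theory.
Import numFieldNormedType.Exports.
Import ComplexField.Normc.

Local Open Scope classical_set_scope.
Local Open Scope ring_scope.
Local Open Scope complex_scope.

(* ** Hyperbolic 3-space *)

Definition H3 (R : realType) := {q : R[i] * R | 0 < q.2}.

Definition hz (R : realType) (q : H3 R) : R[i] := (val q).1.
Definition ht (R : realType) (q : H3 R) : R := (val q).2.

Definition coords (R : realType) (q : H3 R) : R * R * R :=
  (complex.Re (hz q), complex.Im (hz q), ht q).

Definition acosh (R : realType) (u : R) : R := ln (u + Num.sqrt (u ^+ 2 - 1)).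

Definition hdist (R : realType) (x y : H3 R) : R :=
  acosh (1 + (normc (hz x - hz y) ^+ 2 + (ht x - ht y) ^+ 2)
             / (2 * ht x * ht y)).

Definition hdist_set (R : realType) (x : H3 R) (L : set (H3 R)) : R :=
  inf [set hdist x y | y in L].

Definition geodesic_line (R : realType) (g : R -> H3 R) : Prop :=
  forall u v : R, hdist (g u) (g v) = `|u - v|.

(* The points of the geodesic segment [x, y] are exactly those q for which the
   triangle inequality d(x,y) <= d(x,q) + d(q,y) is an equality. *)
Definition hconvex (R : realType) (K : set (H3 R)) : Prop :=
  forall x y q, K x -> K y -> hdist x q + hdist q y = hdist x y -> K q.

(* ** The sphere at infinity; [None] is the point at infinity of the
   Riemann sphere. *)

Definition Chat (R : realType) := option R[i].

(* Closed upper half-space together with infinity, inside the one-point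
   compactification of the ambient Euclidean space. *)
Definition bd (R : realType) (xi : Chat R) :
    one_point_compactification (R * R * R)%type :=
  if xi is Some z then Some (complex.Re z, complex.Im z, 0) else None.

Definition inH (R : realType) (q : H3 R) :
    one_point_compactification (R * R * R)%type := Some (coords q).

Definition line_from_to (R : realType) (g : R -> H3 R) (xi eta : Chat R) :=
  [/\ geodesic_line g,
      inH (g u) @[u --> -oo] --> bd xi &
      inH (g u) @[u --> +oo] --> bd eta].

(* ** Moebius transformations.  An element of PSL(2,C) is given by a matrix
   of determinant 1, well defined up to sign. *)

Definition SL2 (R : realType) (M : 'M[R[i]]_2) : Prop := \det M = 1.

Definition pmeq (R : realType) (M N : 'M[R[i]]_2) : Prop := M = N \/ M = - N.

Definition mob (R : realType) (M : 'M[R[i]]_2) (xi : Chat R) : Chat R :=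
  let a := M ord0 ord0 in let b := M ord0 ord_max in
  let c := M ord_max ord0 in let d := M ord_max ord_max in
  match xi with
  | Some z => if c * z + d == 0 then None else Some ((a * z + b) / (c * z + d))
  | None => if c == 0 then None else Some (a / c)
  end.

(* Poincare extension of [mob M] for det M = 1; [insubd] only supplies a
   default value when the last coordinate is not positive, which does not
   happen for such M (lemma [val_act] below). *)
Definition act_val (R : realType) (M : 'M[R[i]]_2) (q : H3 R) : R[i] * R :=
  let a := M ord0 ord0 in let b := M ord0 ord_max in
  let c := M ord_max ord0 in let d := M ord_max ord_max in
  let z := hz q in let t := ht q in
  let den := normc (c * z + d) ^+ 2 + normc c ^+ 2 * t ^+ 2 in
  (((a * z + b) * conjc (c * z + d) + a * conjc c * (t ^+ 2)%:C) / den%:C,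
   t / den).

Definition act (R : realType) (M : 'M[R[i]]_2) (q : H3 R) : H3 R :=
  insubd q (act_val M q).

Lemma val_act (R : realType) (M : 'M[R[i]]_2) (q : H3 R) :
  SL2 M -> val (act M q) = act_val M q.
Proof.
move=> detM; rewrite /act insubdK // /act_val unfold_in /=.
have t0 : 0 < ht q by exact: (valP q).
apply: divr_gt0 => //.
set c := M ord_max ord0; set d := M ord_max ord_max.
have sq_ge0 (w : R[i]) : 0 <= normc w by case: w => x y; exact: sqrtr_ge0.
rewrite lt0r addr_ge0 ?mulr_ge0 ?exprn_ge0 ?(ltW t0) // andbT.
apply/negP; rewrite paddr_eq0 ?mulr_ge0 ?exprn_ge0 ?(ltW t0) //.
rewrite sqrf_eq0 mulf_eq0 !sqrf_eq0 (gt_eqF t0) orbF.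
move=> /andP[/eqP/eq0_normc cd0 /eqP/eq0_normc c0].
have d0 : d = 0 by move: cd0; rewrite c0 mul0r add0r.
move: detM; rewrite /SL2 (expand_det_row _ ord_max) big1.
  by move=> /eqP; rewrite eq_sym oner_eq0.
move=> j _; case: (unliftP ord_max j) => [k ->|->]; last by rewrite -/d d0 mul0r.
have -> : lift ord_max k = ord0 :> 'I_2 by rewrite ord1; exact/val_inj.
by rewrite -/c c0 mul0r.
Qed.

(* A subgroup of PSL(2,C), represented by its full preimage in SL(2,C). *)
Definition PSL2_subgroup (R : realType) (G : set 'M[R[i]]_2) : Prop :=
  [/\ G `<=` @SL2 R, G 1, G (- 1),
      (forall X Y, G X -> G Y -> G (X * Y)) &
      (forall X, G X -> G X^-1)].

Definition discrete_group (R : realType) (G : set 'M[R[i]]_2) : Prop :=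
  exists2 e : R, 0 < e &
    forall X, G X -> (forall i k, normc ((X - 1) i k) < e) -> X = 1.

Definition Delta (R : realType) : set (Chat R) :=
  [set xi | if xi is Some z then normc z < 1 else False].

Definition Fuchsian (R : realType) (G : set 'M[R[i]]_2) : Prop :=
  [/\ PSL2_subgroup G, discrete_group G &
      forall X, G X -> mob X @` @Delta R = @Delta R].

Definition parabolic (R : realType) (X : 'M[R[i]]_2) : Prop :=
  SL2 X /\ exists! xi, mob X xi = xi.

(* Words in two letters; the second component of a letter tells whether the
   letter is inverted. *)
Definition letter := (bool * bool)%type.

Definition reduced (w : seq letter) : bool :=
  sorted (fun l l' => ~~ ((l.1 == l'.1) && (l.2 != l'.2))) w.

Definition weval (R : realType) (X Y : 'M[R[i]]_2) (w : seq letter) :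
    'M[R[i]]_2 :=
  \prod_(l <- w)
     (let Z := if l.1 then Y else X in if l.2 then Z^-1 else Z).

Definition generators (R : realType) (G : set 'M[R[i]]_2) (X Y : 'M[R[i]]_2) :=
  [/\ G X, G Y & forall Z, G Z -> exists w, pmeq Z (weval X Y w)].

Definition free_rank2 (R : realType) (G : set 'M[R[i]]_2) : Prop :=
  exists X Y, generators G X Y /\
    forall w, reduced w -> w <> [::] -> ~ pmeq (weval X Y w) 1.

Definition comm2 (R : realType) (X Y : 'M[R[i]]_2) : 'M[R[i]]_2 :=
  X * Y * X^-1 * Y^-1.

Definition axis (R : realType) (W : 'M[R[i]]_2) : set (H3 R) :=
  [set q | exists g xi eta, [/\ line_from_to g xi eta,
     mob W xi = xi, mob W eta = eta & range g q]].

(* ** The plane P, its perpendiculars and half-turns *)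

Definition sqn (R : realType) (q : H3 R) : R := normc (hz q) ^+ 2 + ht q ^+ 2.

Definition plane (R : realType) : set (H3 R) := [set q | sqn q = 1].

Definition exterior (R : realType) : set (H3 R) := [set q | 1 < sqn q].

Definition edot (R : realType) (v w : R * R * R) : R :=
  v.1.1 * w.1.1 + v.1.2 * w.1.2 + v.2 * w.2.

(* [perp x g]: g is the line t |-> V_x(t).  The hyperbolic metric is conformal
   to the Euclidean one and the plane lies on the unit sphere, so its tangent
   space at x is the Euclidean orthogonal complement of [coords x]. *)
Definition perp (R : realType) (x : H3 R) (g : R -> H3 R) : Prop :=
  [/\ @plane R x, geodesic_line g, g 0 = x,
      (exists2 v : R * R * R,
         is_derive (0 : R) (1 : R) (fun u => coords (g u)) v &
         forall w, edot w (coords x) = 0 -> edot v w = 0) &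
      forall t, 0 < t -> @exterior R (g t)].

(* [push s K] is {V_x(s) : x in K}, for a subset K of the plane. *)
Definition push (R : realType) (s : R) (K : set (H3 R)) : set (H3 R) :=
  [set q | exists x g, [/\ K x, perp x g & q = g s]].

(* The half-turn H_x: the rotation of order two about V_x. *)
Definition half_turn (R : realType) (x : H3 R) (K : 'M[R[i]]_2) : Prop :=
  [/\ SL2 K, exists2 g, perp x g & forall t, act K (g t) = g t,
      act K <> id & act K \o act K = id].

(* ** Stopping generators with intersecting axes.  Minimality of the traces is
   that of the pair (smaller trace, larger trace). *)
Definition stopping (R : realType) (G : set 'M[R[i]]_2) (A B : 'M[R[i]]_2)
    (p pA pB : H3 R) (Hp HA HB : 'M[R[i]]_2) : Prop :=
  [/\ generators G A B,
      axis A `&` axis B = [set p],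
      [/\ half_turn p Hp, half_turn pA HA & half_turn pB HB],
      pmeq A (Hp * HA) /\ pmeq B (Hp * HB) &
      [/\ hdist p pA <= hdist p pB, hdist p pB <= hdist pA pB &
          forall X Y, generators G X Y ->
            normc (\tr X) <= normc (\tr Y) ->
            normc (\tr A) <= normc (\tr X) /\
            normc (\tr B) <= normc (\tr Y)]].

(* ** Limit set and convex hull *)

Definition limit_set (R : realType) (G : set 'M[R[i]]_2) : set (Chat R) :=
  [set xi | exists q (X : nat -> 'M[R[i]]_2),
     (forall n, G (X n)) /\ inH (act (X n) q) @[n --> \oo] --> bd xi].

Definition hull (R : realType) (L : set (Chat R)) : set (H3 R) :=
  [set q | forall K : set (H3 R), hconvex K ->
     (forall g xi eta, line_from_to g xi eta -> L xi -> L eta ->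
        range g `<=` K) ->
     K q].

Definition core (R : realType) (G : set 'M[R[i]]_2) : set (H3 R) :=
  hull (limit_set G).

(* ** The quotient manifold; its points are the orbits *)

Definition orbitG (R : realType) (G : set 'M[R[i]]_2) (q : H3 R) : set (H3 R) :=
  [set act X q | X in G].

Definition quot (R : realType) (G : set 'M[R[i]]_2) :=
  {O : set (H3 R) | exists q, O = orbitG G q}.

Definition proj (R : realType) (G : set 'M[R[i]]_2) (q : H3 R) : quot G :=
  exist _ (orbitG G q) (ex_intro _ q erefl).

Definition qdist (R : realType) (G : set 'M[R[i]]_2) (O O' : quot G) : R :=
  inf [set r | exists x y, [/\ sval O x, sval O' y & r = hdist x y]].

Definition induces (R : realType) (G : set 'M[R[i]]_2) (K : 'M[R[i]]_2)
    (j : quot G -> quot G) : Prop :=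
  forall q, j (proj G q) = proj G (act K q).

(* The map j is determined by any one of the three [induces] clauses, since
   [proj G] is surjective. *)
Definition hyperelliptic (R : realType) (G : set 'M[R[i]]_2)
    (Hp HA HB : 'M[R[i]]_2) (j : quot G -> quot G) : Prop :=
  [/\ induces Hp j, induces HA j, induces HB j,
      (forall O O', qdist (j O) (j O') = qdist O O') & j \o j = id].

(* ** The surface S(s) *)

Definition N_ext (R : realType) (G : set 'M[R[i]]_2) (s : R) : set (quot G) :=
  proj G @` push s (core G).
Arguments N_ext {R} G s.

Definition N_int (R : realType) (G : set 'M[R[i]]_2) (s : R) : set (quot G) :=
  proj G @` push (- s) (core G).
Arguments N_int {R} G s.

Definition Equi (R : realType) (W : 'M[R[i]]_2) (s : R) : set (H3 R) :=
  [set q | hdist_set q (axis W) = s].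

Definition Equi_cut (R : realType) (W : 'M[R[i]]_2) (s : R) : set (H3 R) :=
  Equi W s `\` (push s (@plane R) `|` push (- s) (@plane R)).

(* The strips are the connected components of [Equi_cut W s] (taken in Euclidean
   coordinates); [Rec] is the one disjoint from the convex hull.  It is the
   open strip; its boundary curves consist of the points V_x(s), V_x(-s) for x
   on the axis, hence project into N_ext(s) and N_int(s). *)
Definition Rec (R : realType) (G : set 'M[R[i]]_2) (W : 'M[R[i]]_2) (s : R) :
    set (H3 R) :=
  [set q | Equi_cut W s q /\
     connected_component (@coords R @` Equi_cut W s) (coords q)
       `&` @coords R @` core G = set0].

Definition funnel (R : realType) (G : set 'M[R[i]]_2) (W : 'M[R[i]]_2) (s : R) :
    set (quot G) :=
  proj G @` Rec G W s.
Arguments funnel {R} G W s.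

Definition surface (R : realType) (G : set 'M[R[i]]_2) (A B : 'M[R[i]]_2)
    (s : R) : set (quot G) :=
  N_ext G s `|` N_int G s `|` funnel G (comm2 B A) s.
Arguments surface {R} G A B s.

(* Main.v *)
(* Identify a point (z, t) of H^3 with the Hermitian matrix
   t^-1 [[|z|^2 + t^2, z], [z^*, 1]] of determinant one, on which SL(2, C) acts by
   X |-> M X M^*.  In this hyperboloid model V_x(t) is cosh t X + sinh t J with
   J = diag(1, -1), so a half-turn about V_x satisfies K J K^* = J: it preserves
   P, its two sides and the equidistant surfaces, and so does G, whose generators
   are products of such half-turns.  Since H_p inverts A and B up to sign, it
   normalizes G and hence preserves the limit set and its hull.  It maps the axis
   of [B, A] to that of [B^-1, A^-1], a G-conjugate of [B, A], so it preserves the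
   funnel as well. *)

Require Import Defs.
From mathcomp Require Import all_boot all_order all_algebra.
From mathcomp Require Import complex ring lra.
From mathcomp Require Import all_classical all_reals all_analysis.

Set Implicit Arguments.
Unset Strict Implicit.
Unset Printing Implicit Defensive.

Import Order.TTheory GRing.Theory Num.Theory.
Import numFieldNormedType.Exports.
Import ComplexField.Normc.

Local Open Scope classical_set_scope.
Local Open Scope ring_scope.
Local Open Scope complex_scope.

(* Without this, [^*] in ring_scope is [Num.conj], only convertible to [conjc]. *)
Local Notation "z ^*" := (conjc z) : ring_scope.
Local Notation "z ^*" := (conjc z) : complex_scope.

(** * The Hermitian matrix model *)

Section HermitianModel.
Variable R : realType.
Implicit Types (M N : 'M[R[i]]_2) (q x y : H3 R).

(** The definitions are metric and topological: V_x is a distance-preserving map with a condition on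
    its Euclidean derivative, limit points are limits in a compactified R^3, and a strip is a
    connected component in Euclidean coordinates. So the linear form of V_x has to be derived, from
    the distances and from the definiteness of the orthogonal complement of a timelike vector, and
    the action has to be continuous up to the boundary. The funnel needs one more step: H_p carries
    the strip along the axis of [B, A] to a strip along another axis. It is therefore replaced by A
    B H_p, which lies in the same coset of G and commutes with [B, A], so that it preserves the axis
    itself. Signs in SL(2, C) do not interfere, because a commutator does not change when its
    arguments change sign. *)

Definition mx2 (a b c d : R[i]) : 'M[R[i]]_2 :=
  \matrix_(i, j) if i == ord0 then (if j == ord0 then a else b)
                 else (if j == ord0 then c else d).

Lemma mx2P M : M = mx2 (M ord0 ord0) (M ord0 ord_max)
                       (M ord_max ord0) (M ord_max ord_max).
Proof.
apply/matrixP => i j; rewrite mxE.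
by case: (unliftP ord0 i) => [k ->|->]; case: (unliftP ord0 j) => [l ->|->];
  rewrite ?ord1 //=; congr (M _ _); apply/val_inj.
Qed.

Lemma mx2_inj a b c d a' b' c' d' : mx2 a b c d = mx2 a' b' c' d' ->
  [/\ a = a', b = b', c = c' & d = d'].
Proof.
move=> /matrixP e; have := e ord0 ord0; have := e ord0 ord_max.
by have := e ord_max ord0; have := e ord_max ord_max; rewrite !mxE.
Qed.

Lemma mul_mx2 a b c d a' b' c' d' : mx2 a b c d *m mx2 a' b' c' d' =
  mx2 (a * a' + b * c') (a * b' + b * d') (c * a' + d * c') (c * b' + d * d').
Proof.
apply/matrixP => i j; rewrite !mxE big_ord_recl big_ord1 !mxE /=.
by case: ifP; case: ifP.
Qed.

Lemma add_mx2 a b c d a' b' c' d' : mx2 a b c d + mx2 a' b' c' d' =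
  mx2 (a + a') (b + b') (c + c') (d + d').
Proof. by apply/matrixP => i j; rewrite !mxE; case: ifP; case: ifP. Qed.

Lemma scale_mx2 k a b c d :
  k *: mx2 a b c d = mx2 (k * a) (k * b) (k * c) (k * d).
Proof. by apply/matrixP => i j; rewrite !mxE; case: ifP; case: ifP. Qed.

Lemma opp_mx2 a b c d : - mx2 a b c d = mx2 (- a) (- b) (- c) (- d).
Proof. by apply/matrixP => i j; rewrite !mxE; case: ifP; case: ifP. Qed.

Lemma mx2_1 : 1 = mx2 1 0 0 1.
Proof. by rewrite (mx2P 1) !mxE. Qed.

Lemma det_mx2_entries M :
  \det M = M ord0 ord0 * M ord_max ord_max - M ord0 ord_max * M ord_max ord0.
Proof.
rewrite (expand_det_row _ ord0) big_ord_recl big_ord1 /cofactor !det_mx11 !mxE.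
rewrite expr0 expr1 mul1r mulN1r mulrN.
by congr (_ * M _ _ - M _ _ * M _ _); apply/val_inj.
Qed.

Lemma det_mx2 a b c d : \det (mx2 a b c d) = a * d - b * c.
Proof. by rewrite det_mx2_entries !mxE. Qed.

Definition mxadj M : 'M[R[i]]_2 := (map_mx conjc M)^T.

Lemma mxadj2 a b c d : mxadj (mx2 a b c d) = mx2 a^* c^* b^* d^*.
Proof. by apply/matrixP => i j; rewrite !mxE; case: ifP; case: ifP. Qed.

Lemma mxadjM M N : mxadj (M *m N) = mxadj N *m mxadj M.
Proof. by rewrite /mxadj map_mxM trmx_mul. Qed.

Lemma mxadj1 : mxadj 1 = 1.
Proof. by rewrite mx2_1 mxadj2 !conjc0 !conjc1. Qed.

Lemma mxadjN M : mxadj (- M) = - mxadj M.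
Proof. by rewrite (mx2P M) opp_mx2 !mxadj2 opp_mx2 !rmorphN. Qed.

Definition mxJ : 'M[R[i]]_2 := mx2 1 0 0 (- 1).

Lemma sqr_normcE (z : R[i]) :
  normc z ^+ 2 = complex.Re z ^+ 2 + complex.Im z ^+ 2.
Proof. by case: z => a b; rewrite sqr_sqrtr // addr_ge0 ?sqr_ge0. Qed.

Lemma sqr_normcC (z : R[i]) : (normc z ^+ 2)%:C = z * z^*.
Proof.
by rewrite sqr_normcE; case: z => a b; congr (_ +i* _) => /=; ring.
Qed.

Lemma ht_gt0 q : 0 < ht q. Proof. exact: valP q. Qed.

Definition herm q : 'M[R[i]]_2 :=
  mx2 (sqn q / ht q)%:C (hz q / (ht q)%:C)
      ((hz q)^* / (ht q)%:C) (ht q)^-1%:C.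

Lemma herm_inj : injective herm.
Proof.
move=> x y /mx2_inj[_ e2 _ /complexI/invr_inj e4].
apply: val_inj; move: e2 e4 (ht_gt0 x); rewrite /hz /ht.
case: (val x) (val y) => [z t] [w u] /= + tu; rewrite tu => e t0.
by congr (_, _); apply: mulIf e; rewrite invr_eq0 eq_complex /= gt_eqF.
Qed.

Lemma SL2E M : SL2 M -> M ord0 ord0 * M ord_max ord_max -
  M ord0 ord_max * M ord_max ord0 = 1.
Proof. by rewrite /SL2 det_mx2_entries. Qed.

Definition act_den M q : R :=
  normc (M ord_max ord0 * hz q + M ord_max ord_max) ^+ 2
  + normc (M ord_max ord0) ^+ 2 * ht q ^+ 2.

Lemma ht_act M q : SL2 M -> ht (act M q) = ht q / act_den M q.
Proof. by move=> dM; rewrite /ht val_act. Qed.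

Lemma hz_act M q : SL2 M -> hz (act M q) =
  ((M ord0 ord0 * hz q + M ord0 ord_max)
     * (M ord_max ord0 * hz q + M ord_max ord_max)^*
   + M ord0 ord0 * (M ord_max ord0)^* * (ht q ^+ 2)%:C) / (act_den M q)%:C.
Proof. by move=> dM; rewrite {1}/hz val_act. Qed.

Lemma act_den_gt0 M q : SL2 M -> 0 < act_den M q.
Proof.
move=> dM; have := ht_gt0 (act M q).
by rewrite ht_act // pmulr_rgt0 ?ht_gt0 // invr_gt0.
Qed.

Lemma real_complexM (u v : R) : (u * v)%:C = u%:C * v%:C.
Proof. by rewrite rmorphM. Qed.

Lemma real_complexD (u v : R) : (u + v)%:C = u%:C + v%:C.
Proof. by rewrite rmorphD. Qed.

Lemma real_complexV (u : R) : (u^-1)%:C = (u%:C)^-1.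
Proof. by rewrite fmorphV. Qed.

Lemma real_complex_neq0 (u : R) : 0 < u -> u%:C != 0.
Proof. by move=> u0; rewrite eq_complex /= gt_eqF. Qed.

Lemma act_denC M q : (act_den M q)%:C =
  (M ord_max ord0 * hz q + M ord_max ord_max) *
  (M ord_max ord0 * hz q + M ord_max ord_max)^*
  + M ord_max ord0 * (M ord_max ord0)^* * ((ht q)%:C * (ht q)%:C).
Proof.
rewrite /act_den real_complexD sqr_normcC.
by rewrite (real_complexM (normc _ ^+ 2)) sqr_normcC expr2 (real_complexM (ht q)).
Qed.

Lemma hermE q : herm q =
  mx2 ((hz q * (hz q)^* + (ht q)%:C * (ht q)%:C) / (ht q)%:C)
      (hz q / (ht q)%:C) ((hz q)^* / (ht q)%:C) ((ht q)%:C)^-1.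
Proof.
rewrite /herm /sqn (expr2 (ht q)) !(real_complexM _ _^-1) real_complexD sqr_normcC.
by rewrite real_complexV (real_complexM (ht q)).
Qed.

Lemma herm_act M q : SL2 M -> herm (act M q) = M *m herm q *m mxadj M.
Proof.
move=> dM; have den0 := real_complex_neq0 (act_den_gt0 q dM).
have t0 := real_complex_neq0 (ht_gt0 q).
have dC := act_denC M q; have e := SL2E dM.
rewrite hermE hermE hz_act // ht_act // [in RHS](mx2P M) mxadj2 !mul_mx2.
rewrite expr2 !real_complexM !real_complexV.
set D := (act_den M q)%:C in dC den0 *; set T := (ht q)%:C in dC t0 *.
have TJ : T^* = T by rewrite /T conjc_real.
have DJ : D^* = D by rewrite /D conjc_real.
clearbody D T; move: dC e; move: (hz q) => z.
move: (M ord0 ord0) (M ord0 ord_max) => a b.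
move: (M ord_max ord0) (M ord_max ord_max) => c d dC e.
have e' : a^* * d^* - b^* * c^* = 1 by rewrite -!rmorphM -rmorphB e rmorph1.
have PJ (x y u : R[i]) : (x * y + u)^* = x^* * y^* + u^* by rewrite rmorphD rmorphM.
have MJ (x y : R[i]) : (x * y)^* = x^* * y^* by rewrite rmorphM.
rewrite !(PJ, MJ) conjc_inv !conjcK TJ DJ; rewrite PJ in dC.
(* The conjugates become independent variables, so that the four entries are rational identities. *)
move: (conjc a) (conjc b) (conjc c) (conjc d) (conjc z) e' dC.
move=> a' b' c' d' z' e' dC.
(* Lagrange's identity for the vectors (a z + b, a T) and (c z + d, c T): D is the squared norm of
   the second, and their determinant has squared modulus T^2. *)
have h00 : (a * z + b) * (a' * z' + b') * D + a * a' * (T * T) * D =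
  ((a * z + b) * (c' * z' + d') + a * c' * (T * T)) *
  ((a' * z' + b') * (c * z + d) + a' * c * (T * T)) + T * T.
  have TT : T * T = (a * d - b * c) * (a' * d' - b' * c') * (T * T).
    by rewrite e e' !mul1r.
  by rewrite dC [X in _ = _ + X]TT; ring.
congr mx2; last by rewrite dC; field; rewrite -?dC ?den0 ?t0.
- rewrite -[RHS](mulfK (mulf_neq0 den0 t0)) -[LHS](mulfK (mulf_neq0 den0 t0)).
  congr (_ / _).
  transitivity (((a * z + b) * (c' * z' + d') + a * c' * (T * T)) *
  ((a' * z' + b') * (c * z + d) + a' * c * (T * T)) + T * T).
    by field; rewrite ?den0 ?t0.
  by rewrite -h00; field; rewrite ?den0 ?t0.
- by field; rewrite ?den0 ?t0.
- by field; rewrite ?den0 ?t0.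
Qed.

(* The hyperbolic cosine of [hdist x y]. *)
Definition chd x y : R :=
  1 + (normc (hz x - hz y) ^+ 2 + (ht x - ht y) ^+ 2) / (2 * ht x * ht y).

Lemma hdistE x y : hdist x y = acosh (chd x y). Proof. by []. Qed.

Lemma chd_ge1 x y : 1 <= chd x y.
Proof.
rewrite lerDl divr_ge0 ?addr_ge0 ?sqr_ge0 //.
by rewrite !mulr_ge0 ?ltW ?ht_gt0.
Qed.

(** The determinant is a quadratic form, equal to 1 at both matrices, and its polar form there is
    twice the hyperbolic cosine of the distance. Isometry of the action then follows from
    multiplicativity of the determinant. *)
Lemma det_hermD x y : \det (herm x + herm y) = (2 * chd x y + 2)%:C.
Proof.
have tx := real_complex_neq0 (ht_gt0 x); have ty := real_complex_neq0 (ht_gt0 y).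
have -> : 2 * chd x y + 2 = 4 +
    (normc (hz x - hz y) ^+ 2 + (ht x - ht y) * (ht x - ht y)) / (ht x * ht y).
  by rewrite /chd; field; rewrite !gt_eqF ?ht_gt0.
have eN : (normc (hz x - hz y) ^+ 2 + (ht x - ht y) * (ht x - ht y))%:C =
    (hz x - hz y) * ((hz x)^* - (hz y)^*)
    + ((ht x)%:C - (ht y)%:C) * ((ht x)%:C - (ht y)%:C).
  by rewrite real_complexD sqr_normcC real_complexM !rmorphB.
have e4 : (4 : R)%:C = 4 by exact: rmorph_nat.
move: (normc _ ^+ 2 + _) eN => N eN.
rewrite real_complexD real_complexM real_complexV real_complexM eN e4.
rewrite !hermE add_mx2 det_mx2.
by field; rewrite tx ty.
Qed.

(** * The action of SL(2, C) by isometries *)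

Lemma SL2_unit M : SL2 M -> M \is a GRing.unit.
Proof. by move=> dM; rewrite unitmxE dM unitr1. Qed.

Lemma det_mxadj M : \det (mxadj M) = (\det M)^*.
Proof. by rewrite det_tr -det_map_mx. Qed.

Lemma SL2M M N : SL2 M -> SL2 N -> SL2 (M * N).
Proof. by rewrite /SL2 => dM dN; rewrite det_mulmx dM dN mulr1. Qed.

Lemma SL2V M : SL2 M -> SL2 M^-1.
Proof. by rewrite /SL2 => dM; rewrite det_inv dM invr1. Qed.

Lemma SL2_1 : SL2 (1 : 'M[R[i]]_2). Proof. exact: det1. Qed.

Lemma SL2N M : SL2 M -> SL2 (- M).
Proof. by rewrite /SL2 -scaleN1r detZ sqrrN expr1n mul1r. Qed.

Lemma chd_act M x y : SL2 M -> chd (act M x) (act M y) = chd x y.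
Proof.
move=> dM; have := det_hermD (act M x) (act M y).
rewrite !herm_act // -mulmxDl -mulmxDr !det_mulmx det_mxadj dM rmorph1 mulr1 mul1r.
have two0 : (2 : R) != 0 by rewrite pnatr_eq0.
by rewrite det_hermD => /complexI/addIr/(mulfI two0).
Qed.

Lemma hdist_act M x y : SL2 M -> hdist (act M x) (act M y) = hdist x y.
Proof. by move=> dM; rewrite !hdistE chd_act. Qed.

Lemma actM M N q : SL2 M -> SL2 N -> act (M * N) q = act M (act N q).
Proof.
move=> dM dN; apply: herm_inj; rewrite !herm_act //; last exact: SL2M.
by rewrite mxadjM !mulmxA.
Qed.

Lemma act1 q : act 1 q = q.
Proof.
apply: herm_inj; rewrite herm_act; last exact: SL2_1.
by rewrite mxadj1 mulmx1 mul1mx.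
Qed.

Lemma actN M q : SL2 M -> act (- M) q = act M q.
Proof.
move=> dM; apply: herm_inj; rewrite !herm_act //; last exact: SL2N.
by rewrite mxadjN mulNmx mulmxN mulNmx opprK.
Qed.

Lemma act_pmeq M N q : SL2 M -> pmeq M N -> act M q = act N q.
Proof.
move=> dM [-> // | e]; rewrite e actN //.
by rewrite -[N]opprK -e; exact: SL2N.
Qed.

Lemma actVK M q : SL2 M -> act M^-1 (act M q) = q.
Proof.
by move=> dM; rewrite -actM ?mulVr ?act1 ?SL2_unit //; exact: SL2V.
Qed.

Lemma actKV M q : SL2 M -> act M (act M^-1 q) = q.
Proof.
by move=> dM; rewrite -actM ?mulrV ?act1 ?SL2_unit //; exact: SL2V.
Qed.

Definition mkH3 (z : R[i]) (t : R) (t0 : 0 < t) : H3 R :=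
  exist (fun q : R[i] * R => 0 < q.2) (z, t) t0.

(** Three test points suffice: those above 0 at heights 1 and 2 force b = c = 0, and (1, 1) then
    forces a = d. This turns the involution property of a half-turn, which is stated for [act], into
    one of matrices up to sign. *)
Lemma act_faithful M : SL2 M -> act M = id -> pmeq M 1.
Proof.
move=> dM eM.
have H q : M *m herm q *m mxadj M = herm q by rewrite -herm_act // eM.
have two0 : (2 : R[i]) != 0 by rewrite pnatr_eq0.
have twoC : (2 : R)%:C = 2 by exact: rmorph_nat.
have hE z t (t0 : 0 < t) : herm (mkH3 z t0) =
    mx2 ((z * z^* + t%:C * t%:C) / t%:C) (z / t%:C) (z^* / t%:C) (t%:C)^-1.
  exact: hermE.
have h1 : herm (mkH3 0 (@ltr01 R)) = mx2 1 0 0 1.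
  by rewrite hE conjc0 rmorph1 !mul0r add0r mulr1 divr1 invr1.
have h2 : herm (mkH3 0 (@ltr0n R 2)) = mx2 2 0 0 2^-1.
  by rewrite hE conjc0 twoC !mul0r add0r mulfK.
have h3 : herm (mkH3 1 (@ltr01 R)) = mx2 2 1 1 1.
  by rewrite hE conjc1 rmorph1 !mulr1 !divr1 invr1.
have := H (mkH3 0 (@ltr01 R)); have := H (mkH3 0 (@ltr0n R 2)).
have := H (mkH3 1 (@ltr01 R)); have det1 := SL2E dM.
rewrite h1 h2 h3 (mx2P M).
rewrite mxadj2 !mul_mx2 mx2_1 /pmeq opp_mx2 oppr0.
move: (M ord0 ord0) (M ord0 ord_max) det1 => a b.
move: (M ord_max ord0) (M ord_max ord_max) => c d det1.
move=> /mx2_inj[_ e3 _ _] /mx2_inj[e2 _ _ e2'] /mx2_inj[e1 _ _ e1'].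
have three0 : (3 : R[i]) != 0 by rewrite pnatr_eq0.
have sq0 (u : R[i]) : u * u^* = 0 -> u = 0.
  by move=> /eqP; rewrite mulf_eq0 conjc_eq0 orbb => /eqP.
have b0 : b = 0.
  apply: sq0; apply: (mulfI three0).
  transitivity (2 * (2 * ((a * 1 + b * 0) * a^* + (a * 0 + b * 1) * b^*)
    - ((a * 2 + b * 0) * a^* + (a * 0 + b * 2^-1) * b^*))).
    by field.
  by rewrite e1 e2; ring.
have c0 : c = 0.
  apply: sq0; apply: (mulfI three0).
  transitivity (2 * ((c * 2 + d * 0) * c^* + (c * 0 + d * 2^-1) * d^*)
    - ((c * 1 + d * 0) * c^* + (c * 0 + d * 1) * d^*)).
    by field.
  by rewrite e1' e2'; field.
move: det1 e1' e3; rewrite b0 c0 conjc0 !(mul0r, mulr0, add0r, addr0, subr0, mulr1).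
move=> ad1 dd1 adJ1.
have dJ0 : d^* != 0.
  by apply/eqP => e; move: dd1; rewrite e mulr0 => /eqP; rewrite eq_sym oner_eq0.
have da : a = d by apply: (mulIf dJ0); rewrite dd1.
rewrite da in ad1; have : (d - 1) * (d + 1) = d * d - 1 by ring.
rewrite da ad1 subrr => /eqP; rewrite mulf_eq0 subr_eq0 addr_eq0.
by move=> /orP[/eqP ->|/eqP ->]; [left|right].
Qed.

End HermitianModel.

(** * Perpendiculars to the plane *)

Section Perpendiculars.
Variable R : realType.
Implicit Types (M N : 'M[R[i]]_2) (q x y : H3 R) (g : R -> H3 R) (u v : R).

(** * Hyperbolic functions and the distance *)

Definition hch u : R := (expR u + expR (- u)) / 2.
Definition hsh u : R := (expR u - expR (- u)) / 2.

(** With r the square root of c^2 - 1, the exponential of acosh c is c + r and its inverse is c - r,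
    so their mean is c. *)
Lemma hdist_hch x y u : hdist x y = `|u| -> chd x y = hch u.
Proof.
rewrite hdistE /acosh => e.
have c1 := chd_ge1 x y; set c := chd x y in c1 e *.
have c0 : 0 <= c by exact: le_trans ler01 c1.
have c2 : 0 <= c ^+ 2 - 1 by rewrite subr_ge0 expr_ge1.
have r0 := sqrtr_ge0 (c ^+ 2 - 1); have r2 := sqr_sqrtr c2.
set r := Num.sqrt _ in e r0 r2.
have cr0 : 0 < c + r by lra.
have hchN : hch `|u| = hch u.
  by case: (ger0P u) => // _; rewrite /hch opprK addrC.
rewrite -hchN -e /hch expRN lnK ?posrE //.
have -> : (c + r)^-1 = c - r.
  by apply: (mulIf (lt0r_neq0 cr0)); rewrite mulVf ?gt_eqF //; nra.
by field.
Qed.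

Lemma hch2_sub_hsh2 u : hch u * hch u - hsh u * hsh u = 1.
Proof.
rewrite /hch /hsh expRN; have := expR_gt0 u => e0.
by field; rewrite gt_eqF.
Qed.

Lemma hchB u v : hch (u - v) = hch u * hch v - hsh u * hsh v.
Proof.
rewrite /hch /hsh opprB !expRD !expRN.
have := expR_gt0 u => e0; have := expR_gt0 v => e1.
by field; rewrite !gt_eqF.
Qed.

Lemma hch0 : hch 0 = 1.
Proof. by rewrite /hch oppr0 expR0; field. Qed.

Lemma hsh0 : hsh 0 = 0.
Proof. by rewrite /hsh oppr0 expR0 subrr mul0r. Qed.

Lemma hsh_gt0 u : 0 < u -> 0 < hsh u.
Proof. by move=> u0; rewrite divr_gt0 // subr_gt0 ltr_expR; lra. Qed.

Global Instance is_derive_hch u : is_derive u 1 hch (hsh u).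
Proof.
rewrite /hch /hsh; apply: is_derive_eq.
by rewrite /= /GRing.scale /=; ring.
Qed.

Global Instance is_derive_hsh u : is_derive u 1 hsh (hch u).
Proof.
rewrite /hch /hsh; apply: is_derive_eq.
by rewrite /= /GRing.scale /=; ring.
Qed.

(** The real content of [herm q]: its diagonal, then the real and imaginary parts of its upper right
    entry. Real vectors suit differentiation and linear arithmetic. *)
Definition lv q : R * R * R * R :=
  (sqn q / ht q, (ht q)^-1, complex.Re (hz q) / ht q, complex.Im (hz q) / ht q).

(* Twice the Lorentz form in light-cone coordinates, the polar form of [\det]. *)
Definition lform (v w : R * R * R * R) : R :=
  v.1.1.1 * w.1.1.2 + v.1.1.2 * w.1.1.1 - 2 * v.1.2 * w.1.2 - 2 * v.2 * w.2.

Lemma lform_lv x y : lform (lv x) (lv y) = 2 * chd x y.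
Proof.
have tx := ht_gt0 x; have ty := ht_gt0 y.
rewrite /lform /lv /chd /sqn /= !sqr_normcE.
case: (hz x) (hz y) => [a b] [c d] /=.
by field; rewrite !gt_eqF.
Qed.

(* Reverse Cauchy-Schwarz: the orthogonal complement of a timelike vector is
   definite. *)
Lemma lform_orth (a0 d0 x0 y0 a d x y : R) :
  a0 * d0 - x0 ^+ 2 - y0 ^+ 2 = 1 -> 0 < d0 ->
  a0 * d + d0 * a - 2 * x0 * x - 2 * y0 * y = 0 ->
  a * d - x ^+ 2 - y ^+ 2 = 0 ->
  [/\ a = 0, d = 0, x = 0 & y = 0].
Proof.
move=> e0 d0_gt0 eo ed.
have a0_gt0 : 0 < a0 by rewrite -(pmulr_lgt0 _ d0_gt0); nra.
have cs : (x0 * x + y0 * y) ^+ 2 <= (x0 ^+ 2 + y0 ^+ 2) * (x ^+ 2 + y ^+ 2).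
  rewrite -subr_ge0.
  have -> : (x0 ^+ 2 + y0 ^+ 2) * (x ^+ 2 + y ^+ 2) - (x0 * x + y0 * y) ^+ 2 =
    (x0 * y - y0 * x) ^+ 2 by ring.
  exact: sqr_ge0.
have am : 4 * (a0 * d0) * (a * d) <= (2 * (x0 * x + y0 * y)) ^+ 2.
  have -> : 2 * (x0 * x + y0 * y) = a0 * d + d0 * a by lra.
  rewrite -subr_ge0.
  have -> : (a0 * d + d0 * a) ^+ 2 - 4 * (a0 * d0) * (a * d) =
    (a0 * d - d0 * a) ^+ 2 by ring.
  exact: sqr_ge0.
have ad : a * d = x ^+ 2 + y ^+ 2 by lra.
have s0 : x0 ^+ 2 + y0 ^+ 2 = a0 * d0 - 1 by lra.
(* With S = x^2 + y^2, [am] and [cs] combine to 4 a0 d0 S <= 4 (a0 d0 - 1) S. *)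
have le0 : x ^+ 2 + y ^+ 2 <= 0.
  by rewrite s0 -ad in cs; rewrite exprMn in am; nra.
have := sqr_ge0 x; have := sqr_ge0 y => y2 x2.
have xx : x = 0 by apply/eqP; rewrite -sqrf_eq0; apply/eqP; lra.
have yy : y = 0 by apply/eqP; rewrite -sqrf_eq0; apply/eqP; lra.
move: ad eo; rewrite xx yy expr0n addr0 => /eqP.
rewrite mulf_eq0 => /orP[/eqP a0'|/eqP d0'].
  rewrite a0' => eo; split => //.
  have /eqP : a0 * d = 0 by lra.
  by rewrite mulf_eq0 gt_eqF //= => /eqP.
rewrite d0' => eo; split => //.
have /eqP : d0 * a = 0 by lra.
by rewrite mulf_eq0 gt_eqF //= => /eqP.
Qed.

Lemma lv_det q : (lv q).1.1.1 * (lv q).1.1.2 - (lv q).1.2 ^+ 2 - (lv q).2 ^+ 2 = 1.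
Proof.
have tq := ht_gt0 q; rewrite /lv /sqn /= sqr_normcE.
by field; rewrite gt_eqF.
Qed.

Lemma lform_lv_eq0 x (w : R * R * R * R) :
  lform (lv x) w = 0 -> lform w w = 0 -> w = 0.
Proof.
case: w => [[[a d] b] c]; rewrite /lform /= => eo ew.
have dx : 0 < (lv x).1.1.2 by rewrite invr_gt0 ht_gt0.
have [|-> -> -> ->] // := lform_orth (lv_det x) dx eo.
by move: ew; rewrite !expr2; lra.
Qed.

Lemma lformC (v w : R * R * R * R) : lform v w = lform w v.
Proof. by rewrite /lform; ring. Qed.

Lemma lformBr (v w w' : R * R * R * R) :
  lform v (w - w') = lform v w - lform v w'.
Proof. by rewrite /lform /=; ring. Qed.

Lemma lformZr (v w : R * R * R * R) (k : R) : lform v (k *: w) = k * lform v w.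
Proof. by rewrite /lform /= /GRing.scale /=; ring. Qed.

Lemma lformBl (v w w' : R * R * R * R) :
  lform (w - w') v = lform w v - lform w' v.
Proof. by rewrite !(lformC _ v) lformBr. Qed.

Lemma lformZl (v w : R * R * R * R) (k : R) : lform (k *: w) v = k * lform w v.
Proof. by rewrite !(lformC _ v) lformZr. Qed.

Definition lformE := (lformBr, lformBl, lformZr, lformZl).

(* In the hyperboloid model a geodesic is [cosh u *: g 0 + sinh u *: Y]. *)
Lemma geodesic_lv g : geodesic_line g -> exists Y : R * R * R * R,
  [/\ lform (lv (g 0)) Y = 0, lform Y Y = - 2 &
      forall u, lv (g u) = hch u *: lv (g 0) + hsh u *: Y].
Proof.
move=> gg; have C u v : lform (lv (g u)) (lv (g v)) = 2 * hch (u - v).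
  by rewrite lform_lv; congr (2 * _); exact: hdist_hch.
have S1 : 0 < hsh 1 by exact: hsh_gt0.
have s1 : hsh 1 != 0 by rewrite gt_eqF.
have hchN u : hch (- u) = hch u by rewrite /hch opprK addrC.
(* The formula at u = 1 forces this value; an equation instead of a local definition keeps Y
   opaque. *)
have [Y YE] : exists Y, Y = (hsh 1)^-1 *: (lv (g 1) - hch 1 *: lv (g 0)) by eexists.
have B0Y : lform (lv (g 0)) Y = 0.
  by rewrite YE !lformE !C subrr sub0r hchN hch0; field.
have BYu u : lform (lv (g u)) Y = - 2 * hsh u.
  rewrite YE !lformE !C subr0 hchB.
  by field.
have BYY : lform Y Y = - 2.
  rewrite {1}YE !lformE B0Y BYu; by field.
exists Y; split => // u; apply/eqP; rewrite -subr_eq0 opprD addrA; apply/eqP.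
have ch2 := hch2_sub_hsh2 u.
(* The difference of the two sides is null and orthogonal to the timelike [lv (g 0)], hence zero. *)
apply: (@lform_lv_eq0 (g 0)).
  by rewrite !lformE B0Y !C subrr sub0r hchN hch0; ring.
rewrite !lformE B0Y BYY BYu !(lformC Y) B0Y BYu !C !subrr subr0 sub0r hchN hch0.
transitivity (2 * (1 - (hch u * hch u - hsh u * hsh u))); first by ring.
by rewrite ch2 subrr mulr0.
Qed.

(** * Derivatives of geodesics in Euclidean coordinates *)

Lemma is_derive_cvg (V : normedModType R) (f : R -> V) u df :
  is_derive u 1 f df <->
  h^-1 *: (f (h + u) - f u) @[h --> (0 : R)^'] --> df.
Proof.
have e : (fun h : R => h^-1 *: (f (h + u) - f u)) =
  (fun h : R => h^-1 *: ((f \o shift u) (h *: 1) - f u)).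
  by apply/funext => h /=; rewrite [h *: 1]mulr1.
rewrite e; split=> [[dv <-]|cv]; first exact: dv.
by apply: DeriveDef; [exact: cvgP cv|exact: cvg_lim cv].
Qed.

Lemma is_derive_pair (U V : normedModType R) (f : R -> U) (g : R -> V) u df dg :
  is_derive u 1 f df -> is_derive u 1 g dg ->
  is_derive u 1 (fun r => (f r, g r)) (df, dg).
Proof.
move=> /is_derive_cvg cf /is_derive_cvg cg; apply/is_derive_cvg.
exact: cvg_pair cf cg.
Qed.

Lemma is_derive_unique (V : normedModType R) (f : R -> V) u df dg :
  is_derive u 1 f df -> is_derive u 1 f dg -> df = dg.
Proof. by move=> [_ <-] [_ <-]. Qed.

Lemma coords_lv q : coords q =
  ((lv q).1.2 / (lv q).1.1.2, (lv q).2 / (lv q).1.1.2, ((lv q).1.1.2)^-1).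
Proof.
by rewrite /lv /= !invrK !divfK ?gt_eqF ?ht_gt0.
Qed.

Lemma plane_lv x : @plane R x <-> (lv x).1.1.1 = (lv x).1.1.2.
Proof.
have tx := ht_gt0 x; rewrite /plane /lv /=; split=> [->|]; first by rewrite mul1r.
move=> e; apply: (mulIf (lt0r_neq0 _)); rewrite ?mul1r; last exact: e.
by rewrite invr_gt0.
Qed.

Lemma exterior_lv x : @exterior R x <-> (lv x).1.1.2 < (lv x).1.1.1.
Proof.
by have tx := ht_gt0 x; rewrite /exterior /lv /= ltr_pdivlMr ?mulVf ?gt_eqF.
Qed.

Lemma is_derive_hch_hsh (a b : R) :
  is_derive (0 : R) (1 : R) (fun u : R => hch u * a + hsh u * b) b.
Proof.
apply: is_derive_eq.
by rewrite /= /GRing.scale /= hch0 hsh0; ring.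
Qed.

Lemma is_derive_inv0 (f : R -> R) (df : R) : f 0 != 0 ->
  is_derive (0 : R) (1 : R) f df ->
  is_derive (0 : R) (1 : R) (fun u : R => (f u)^-1) (- df / f 0 ^+ 2).
Proof.
move=> f0 dv; apply: is_derive_eq.
by rewrite /GRing.scale /= !mulNr mulrC.
Qed.

(** The quotient rule applied to [coords_lv] at u = 0, where [hch] has value 1 and slope 0, and
    [hsh] has value 0 and slope 1. *)
Lemma is_derive_coords (Y : R * R * R * R) x g :
  (forall u, lv (g u) = hch u *: lv x + hsh u *: Y) ->
  is_derive (0 : R) (1 : R) (fun u => coords (g u))
    ((Y.1.2 - (lv x).1.2 * Y.1.1.2 * ht x) * ht x,
     (Y.2 - (lv x).2 * Y.1.1.2 * ht x) * ht x, - Y.1.1.2 * ht x ^+ 2).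
Proof.
move=> gE.
have -> : (fun u => coords (g u)) = (fun u =>
  ((hch u * (lv x).1.2 + hsh u * Y.1.2) / (hch u * (lv x).1.1.2 + hsh u * Y.1.1.2),
   (hch u * (lv x).2 + hsh u * Y.2) / (hch u * (lv x).1.1.2 + hsh u * Y.1.1.2),
   (hch u * (lv x).1.1.2 + hsh u * Y.1.1.2)^-1)).
  by apply/funext => u; rewrite coords_lv gE.
have dl : (lv x).1.1.2 = (ht x)^-1 by [].
have t0 := ht_gt0 x.
have n0 : hch 0 * (lv x).1.1.2 + hsh 0 * Y.1.1.2 != 0.
  by rewrite hch0 hsh0 mul1r mul0r addr0 dl invr_eq0 gt_eqF.
have e0 : hch 0 * (lv x).1.1.2 + hsh 0 * Y.1.1.2 = (ht x)^-1.
  by rewrite hch0 hsh0 mul1r mul0r addr0.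
have dV := is_derive_inv0 n0 (is_derive_hch_hsh _ _).
have dM a b : is_derive (0 : R) (1 : R) (fun u : R => (hch u * a + hsh u * b) /
    (hch u * (lv x).1.1.2 + hsh u * Y.1.1.2)) ((b - a * Y.1.1.2 * ht x) * ht x).
  have dN := is_derive_hch_hsh a b.
  apply: is_derive_eq.
  rewrite /= /GRing.scale /= e0 hch0 hsh0.
  by field; rewrite gt_eqF.
apply: is_derive_pair; first apply: is_derive_pair => //.
have -> : - Y.1.1.2 * ht x ^+ 2 =
    - Y.1.1.2 / (hch 0 * (lv x).1.1.2 + hsh 0 * Y.1.1.2) ^+ 2; last exact: dV.
by rewrite e0; field; rewrite gt_eqF.
Qed.

(** The direction Y is determined in three stages: Euclidean orthogonality to the plane kills its
    last two components, orthogonality to [lv x] makes the first two opposite, and the norm together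
    with the exterior side makes them 1 and -1. *)
Lemma perp_lv x g : perp x g ->
  forall u, lv (g u) = hch u *: lv x + hsh u *: (1, -1, 0, 0).
Proof.
case=> Px gg g0 [v dv orth] ext.
have [Y [B0 BY gE]] := geodesic_lv gg; rewrite g0 in B0 gE.
suff -> : (1, -1, 0, 0) = Y by [].
have := is_derive_unique dv (is_derive_coords gE).
have t0 := ht_gt0 x; have tn0 := lt0r_neq0 t0.
(* These two vectors span the tangent plane of the unit sphere at x. *)
have := orth (ht x, 0, - complex.Re (hz x)).
have := orth (0, ht x, - complex.Im (hz x)).
rewrite /edot /= => o2 o1 vE; rewrite vE /= in o1 o2.
have Y3 : Y.1.2 = 0.
  apply: (mulIf (mulf_neq0 tn0 tn0)); rewrite mul0r -[RHS]o1; last by ring.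
  by field.
have Y4 : Y.2 = 0.
  apply: (mulIf (mulf_neq0 tn0 tn0)); rewrite mul0r -[RHS]o2; last by ring.
  by field.
have /plane_lv aE := Px.
have dx : 0 < (lv x).1.1.2 by rewrite invr_gt0.
have Y1 : Y.1.1.1 = - Y.1.1.2.
  move: B0; rewrite /lform Y3 Y4 aE !mulr0 !subr0 -mulrDr => /eqP.
  by rewrite mulf_eq0 gt_eqF //= addrC addr_eq0 => /eqP.
have Y1gt0 : 0 < Y.1.1.1.
  have g1 : (lv (g 1)).1.1.1 = hch 1 * (lv x).1.1.1 + hsh 1 * Y.1.1.1 by rewrite gE.
  have g2 : (lv (g 1)).1.1.2 = hch 1 * (lv x).1.1.2 + hsh 1 * Y.1.1.2 by rewrite gE.
  have /exterior_lv := ext 1 ltr01; rewrite g1 g2 aE -subr_gt0.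
  have -> : hch 1 * (lv x).1.1.2 + hsh 1 * Y.1.1.1 -
    (hch 1 * (lv x).1.1.2 + hsh 1 * Y.1.1.2) = 2 * hsh 1 * Y.1.1.1.
    by rewrite Y1; ring.
  by rewrite pmulr_rgt0 // mulr_gt0 ?hsh_gt0.
have Y11 : Y.1.1.1 = 1.
  move: BY; rewrite /lform Y3 Y4.
  have -> : Y.1.1.2 = - Y.1.1.1 by rewrite Y1 opprK.
  move=> e; have : (Y.1.1.1 - 1) * (Y.1.1.1 + 1) = 0 by lra.
  have /gt_eqF n0 : 0 < Y.1.1.1 + 1 by rewrite addr_gt0.
  by move=> /eqP; rewrite mulf_eq0 n0 orbF subr_eq0 => /eqP.
have Y12 : Y.1.1.2 = -1 by rewrite -Y11 Y1 opprK.
case: Y Y3 Y4 Y11 Y12 {B0 BY gE o1 o2 vE Y1 Y1gt0} => [[[a d] b] c] /=.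
by move=> -> -> -> ->.
Qed.

Lemma herm_lv q : herm q =
  mx2 (lv q).1.1.1%:C ((lv q).1.2 +i* (lv q).2)
      ((lv q).1.2 +i* - (lv q).2) (lv q).1.1.2%:C.
Proof.
have tq := ht_gt0 q; rewrite /herm /lv -real_complexV //.
by case: (hz q) => a b; congr mx2; congr (_ +i* _) => /=; ring.
Qed.

Lemma lv_herm_comb q x (h k : R) :
  lv q = h *: lv x + k *: (1, -1, 0, 0) <->
  herm q = h%:C *: herm x + k%:C *: mxJ R.
Proof.
rewrite !herm_lv /mxJ !scale_mx2 add_mx2.
case: (lv q) (lv x) => [[[a d] b] c] [[[a' d'] b'] c'] /=.
split=> [[-> -> -> ->]|/mx2_inj].
  by rewrite /GRing.scale /=; congr mx2; congr (_ +i* _) => /=; ring.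
case=> -[e1 _] [e2 e3] _ [e4 _].
by rewrite e1 e2 e3 e4; congr (_, _, _, _); rewrite /= /GRing.scale /=; ring.
Qed.

(** Since J has determinant -1, this determinant is the polar form of [herm x] and J: the plane is
    the orthogonal complement of J. In this form, invariance under maps that fix J is
    multiplicativity of the determinant. *)
Lemma plane_herm x : @plane R x <-> \det (herm x + mxJ R) = 0.
Proof.
have -> : \det (herm x + mxJ R) = ((lv x).1.1.2 - (lv x).1.1.1)%:C.
  rewrite herm_lv add_mx2 det_mx2; have := lv_det x.
  case: (lv x) => [[[a d] b] c] /= e.
  congr (_ +i* _) => /=; last by ring.
  transitivity (a * d - b ^+ 2 - c ^+ 2 - 1 + (d - a)); first by ring.
  by rewrite e; ring.
apply: (iff_trans (plane_lv x)); split=> [->|/complexI/eqP].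
  by rewrite subrr.
by rewrite subr_eq0 => /eqP ->.
Qed.

(** Fixing J exactly, and not only up to sign, keeps the two sides of the plane apart. *)
Definition presJ M : Prop := M *m mxJ R *m mxadj M = mxJ R.

Lemma plane_act M x : SL2 M -> presJ M -> @plane R x -> @plane R (act M x).
Proof.
move=> dM JM /plane_herm Px; apply/plane_herm.
by rewrite herm_act // -JM -mulmxDl -mulmxDr !det_mulmx Px mulr0 mul0r.
Qed.

Lemma perp_act M x g : SL2 M -> presJ M ->
  perp x g -> perp (act M x) (act M \o g).
Proof.
move=> dM JM px; have gE := perp_lv px; case: px => Px gg g0 _ _.
have gME u : lv ((act M \o g) u) =
    hch u *: lv (act M x) + hsh u *: (1, -1, 0, 0).
  have /lv_herm_comb e := gE u; apply/lv_herm_comb.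
  rewrite !herm_act // e mulmxDr mulmxDl -!scalemxAr -!scalemxAl.
  by rewrite JM.
have PM := plane_act dM JM Px.
split => //.
- by move=> u v; rewrite /= hdist_act.
- by rewrite /= g0.
(* The outward normal of the unit sphere, with Euclidean length the height, that is, of hyperbolic
   length 1. *)
- exists (ht (act M x) *: coords (act M x)).
    have := is_derive_coords gME => /=; set v := (X in is_derive _ _ _ X).
    move=> dv; have -> : ht (act M x) *: coords (act M x) = v; last exact: dv.
    rewrite /v /coords /GRing.scale /=.
    have t0 := ht_gt0 (act M x).
    by congr (_, _, _); rewrite /= /GRing.scale /=; field; rewrite ?gt_eqF.
  move=> w; rewrite /edot /= /GRing.scale /= => e.
  transitivity (ht (act M x) * edot w (coords (act M x))).
    by rewrite /edot /=; ring.
  by rewrite /edot /= e mulr0.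
- move=> t t0; apply/exterior_lv; move/plane_lv: PM => PM.
  have -> : (lv ((act M \o g) t)).1.1.1 =
    hch t * (lv (act M x)).1.1.1 + hsh t * 1 by rewrite gME.
  have -> : (lv ((act M \o g) t)).1.1.2 =
    hch t * (lv (act M x)).1.1.2 + hsh t * -1 by rewrite gME.
  by rewrite PM; have := hsh_gt0 t0; lra.
Qed.

Lemma presJM M N : presJ M -> presJ N -> presJ (M * N).
Proof.
rewrite /presJ => JM JN; rewrite mxadjM.
by rewrite -{2}JM -{2}JN !mulmxA.
Qed.

Lemma presJV M : SL2 M -> presJ M -> presJ M^-1.
Proof.
rewrite /presJ => dM JM; rewrite -{1}JM !mulmxA.
have -> : M^-1 *m M = 1 by exact: (mulVr (SL2_unit dM)).
rewrite mul1mx -mulmxA -mxadjM.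
have -> : M^-1 *m M = 1 by exact: (mulVr (SL2_unit dM)).
by rewrite mxadj1 mulmx1.
Qed.

Lemma presJN M : presJ M -> presJ (- M).
Proof. by rewrite /presJ mxadjN mulNmx mulNmx mulmxN opprK. Qed.

(** Two points of the fixed line are enough: the action on Hermitian matrices is linear and fixes X
    and cosh 1 X + sinh 1 J, hence J. *)
Lemma half_turn_presJ x M : half_turn x M -> presJ M.
Proof.
case=> dM [g pg fixg] _ _; have gE := perp_lv pg.
have H u : M *m herm (g u) *m mxadj M = herm (g u) by rewrite -herm_act ?fixg.
have hg1 : herm (g 1) = (hch 1)%:C *: herm x + (hsh 1)%:C *: mxJ R.
  exact/lv_herm_comb.
have := H 0; case: pg => _ _ -> _ _ => Hx.
have := H 1; rewrite hg1 mulmxDr mulmxDl -!scalemxAr -!scalemxAl Hx.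
move=> /addrI; apply: scalerI.
by rewrite real_complex_neq0 // hsh_gt0.
Qed.

Lemma half_turn_sq x M : half_turn x M -> pmeq (M * M) 1.
Proof.
case=> dM _ _ sq; apply: act_faithful; first exact: SL2M.
by rewrite -[RHS]sq; apply/funext => q; rewrite actM.
Qed.

Lemma push_act M s (K : set (H3 R)) : SL2 M -> presJ M ->
  (forall x, K x -> K (act M x)) -> forall q, push s K q -> push s K (act M q).
Proof.
move=> dM JM KM _ [x [g [Kx pg ->]]].
exists (act M x), (act M \o g); split => //; first exact: KM.
exact: perp_act.
Qed.

End Perpendiculars.

(** * The action at infinity *)

Section Boundary.
Variable R : realType.
Implicit Types (M N : 'M[R[i]]_2) (q x y : H3 R) (xi : Chat R).

(** The formula of [act] extended to all of R^3: at height 0 it is the Moebius map, so one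
    continuity statement serves both the interior and the boundary. *)
Definition den_fun M (v : R * R * R) : R :=
  normc (M ord_max ord0 * (v.1.1 +i* v.1.2) + M ord_max ord_max) ^+ 2
  + normc (M ord_max ord0) ^+ 2 * v.2 ^+ 2.

Definition num_fun M (v : R * R * R) : R[i] :=
  (M ord0 ord0 * (v.1.1 +i* v.1.2) + M ord0 ord_max)
     * (M ord_max ord0 * (v.1.1 +i* v.1.2) + M ord_max ord_max)^*
   + M ord0 ord0 * (M ord_max ord0)^* * (v.2 ^+ 2)%:C.

Definition act_fun M (v : R * R * R) : R * R * R :=
  (complex.Re (num_fun M v) / den_fun M v,
   complex.Im (num_fun M v) / den_fun M v, v.2 / den_fun M v).

Lemma coords_hz q : (coords q).1.1 +i* (coords q).1.2 = hz q.
Proof. by rewrite /coords /=; case: (hz q). Qed.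

Lemma den_fun_coords M q : den_fun M (coords q) = act_den M q.
Proof. by rewrite /den_fun coords_hz. Qed.

Lemma divc_real (z : R[i]) (u : R) :
  z / u%:C = (complex.Re z / u) +i* (complex.Im z / u).
Proof.
by rewrite -real_complexV; case: z => a b; congr (_ +i* _) => /=; ring.
Qed.

Lemma coords_act M q : SL2 M -> coords (act M q) = act_fun M (coords q).
Proof.
move=> dM; rewrite /act_fun /num_fun den_fun_coords coords_hz.
by rewrite /coords hz_act // ht_act //= divc_real.
Qed.

(* Boxed, since simplification would unfold a bare [continuous f]. *)
Variant is_cont (T : topologicalType) (f : T -> R) : Prop :=
  IsCont of continuous f.

Lemma contD (T : topologicalType) (f g : T -> R) : is_cont f -> is_cont g ->
  is_cont (fun v => f v + g v).
Proof. by move=> [cf] [cg]; split=> v; apply: cvgD; [exact: cf|exact: cg]. Qed.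

Lemma contM (T : topologicalType) (f g : T -> R) : is_cont f -> is_cont g ->
  is_cont (fun v => f v * g v).
Proof. by move=> [cf] [cg]; split=> v; apply: cvgM; [exact: cf|exact: cg]. Qed.

Lemma contN (T : topologicalType) (f : T -> R) : is_cont f ->
  is_cont (fun v => - f v).
Proof. by move=> [cf]; split=> v; apply: cvgN; exact: cf. Qed.

Lemma cont_fst1 : is_cont (fun v : R * R * R => v.1.1).
Proof. by split=> v; apply: (cvg_comp fst fst); exact: cvg_fst. Qed.

Lemma cont_fst2 : is_cont (fun v : R * R * R => v.1.2).
Proof. by split=> v; apply: (cvg_comp fst snd); [exact: cvg_fst|exact: cvg_snd]. Qed.

Lemma cont_snd : is_cont (fun v : R * R * R => v.2).
Proof. by split=> v; exact: cvg_snd. Qed.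

Lemma cont_cst (T : topologicalType) (k : R) : is_cont (fun _ : T => k).
Proof. by split=> v; exact: cvg_cst. Qed.

Ltac cont_poly := lazymatch goal with
  | |- is_cont (fun v => @GRing.add _ (@?f v) (@?g v)) =>
      refine (@contD _ f g _ _); cont_poly
  | |- is_cont (fun v => @GRing.mul _ (@?f v) (@?g v)) =>
      refine (@contM _ f g _ _); cont_poly
  | |- is_cont (fun v => @GRing.opp _ (@?f v)) =>
      refine (@contN _ f _); cont_poly
  | |- is_cont (fun v => v.1.1) => exact: cont_fst1
  | |- is_cont (fun v => v.1.2) => exact: cont_fst2
  | |- is_cont (fun v => v.2) => exact: cont_snd
  | |- is_cont (fun v => ?k) => exact: cont_cst
  end.

Lemma continuous_den_fun M : is_cont (den_fun M).
Proof.
have -> : den_fun M = (fun v : R * R * R =>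
  complex.Re (M ord_max ord0 * (v.1.1 +i* v.1.2) + M ord_max ord_max) ^+ 2 +
  complex.Im (M ord_max ord0 * (v.1.1 +i* v.1.2) + M ord_max ord_max) ^+ 2 +
  normc (M ord_max ord0) ^+ 2 * v.2 ^+ 2).
  by apply/funext => v; rewrite /den_fun sqr_normcE.
case: (M ord_max ord0) (M ord_max ord_max) => [c1 c2] [d1 d2] /=.
under eq_fun do rewrite !expr2.
by cont_poly.
Qed.

Lemma continuous_num_Re M : is_cont (fun v => complex.Re (num_fun M v)).
Proof.
rewrite /num_fun.
case: (M ord0 ord0) (M ord0 ord_max) => [a1 a2] [b1 b2].
case: (M ord_max ord0) (M ord_max ord_max) => [c1 c2] [d1 d2] /=.
under eq_fun do rewrite !expr2.
by cont_poly.
Qed.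

Lemma continuous_num_Im M : is_cont (fun v => complex.Im (num_fun M v)).
Proof.
rewrite /num_fun.
case: (M ord0 ord0) (M ord0 ord_max) => [a1 a2] [b1 b2].
case: (M ord_max ord0) (M ord_max ord_max) => [c1 c2] [d1 d2] /=.
under eq_fun do rewrite !expr2.
by cont_poly.
Qed.

Lemma act_fun_cvg M (v : R * R * R) : den_fun M v != 0 ->
  act_fun M @ v --> act_fun M v.
Proof.
move=> d0; have [cd] := continuous_den_fun M.
have [cr] := continuous_num_Re M; have [ci] := continuous_num_Im M.
have [c2] := cont_snd.
have cV : (fun w => (den_fun M w)^-1) @ v --> (den_fun M v)^-1.
  by apply: cvgV => //; exact: cd.
have H (f : R * R * R -> R) : f @ v --> f v ->
    (fun w => f w / den_fun M w) @ v --> f v / den_fun M v.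
  by move=> cf; exact: cvgM.
have cr' := H _ (cr v); have ci' := H _ (ci v); have c2' := H _ (c2 v).
exact: (cvg_pair (cvg_pair cr' ci') c2').
Qed.

(** * Convergence to boundary points *)

Section Limits.
Context {T : Type} (F : set_system T) {FF : Filter F}.
Implicit Types f : T -> H3 R.

Lemma inH_cvg_some f (v : R * R * R) :
  (inH (f u) @[u --> F] -->
     (Some v : one_point_compactification (R * R * R)%type)) <->
  coords (f u) @[u --> F] --> v.
Proof.
split=> cf U /= nU; last exact: cf nU.
have : F [set u | (Some @` U) (inH (f u))].
  exact: cf _ (@one_point_compactification_some_nbhs _ v U nU).
move=> nF; change (F [set u | U (coords (f u))]).
by apply: filterS nF => u [w Uw [e]]; rewrite e in Uw.
Qed.

Lemma sqn_coords q : sqn q = (coords q).1.1 * (coords q).1.1 +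
  (coords q).1.2 * (coords q).1.2 + (coords q).2 * (coords q).2.
Proof. by rewrite /sqn sqr_normcE /= !expr2. Qed.

Lemma inH_cvg_none f :
  (inH (f u) @[u --> F] -->
     (None : one_point_compactification (R * R * R)%type)) <->
  forall r, \forall u \near F, r < sqn (f u).
Proof.
split=> [cf r|cf U [C [cC _] CU]].
  (* The cube over I contains the ball [sqn <= r], because k^2 <= r gives |k| <= |r| + 1. *)
  pose I := [set` `[- (`|r| + 1), `|r| + 1]] : set R.
  have cI : compact I by exact: segment_compact.
  have cC : compact ((I `*` I) `*` I) by do 2!apply: compact_setX => //.
  have : nbhs (None : one_point_compactification (R * R * R)%type)
      (Some @` (~` ((I `*` I) `*` I)) `|` [set None]).
    exists ((I `*` I) `*` I) => //; split => //.
    by apply: compact_closed => //; exact: norm_hausdorff.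
  move=> /cf nF; change (F [set u |
    (Some @` (~` ((I `*` I) `*` I)) `|` [set None]) (inH (f u))]) in nF.
  apply: filterS nF => u [[w nw [we]]|//].
  rewrite we in nw; rewrite ltNge; apply/negP => le; apply: nw.
  rewrite sqn_coords in le.
  have H (k : R) : k * k <= r -> I k.
    move=> kr; rewrite /I /= in_itv /= -ler_norml.
    have : `|k| * `|k| <= r by rewrite -normrM ger0_norm // -expr2 sqr_ge0.
    have := ler_norm r; have := normr_ge0 k; have := normr_ge0 r; nra.
  have := sqr_ge0 (coords (f u)).1.1; have := sqr_ge0 (coords (f u)).1.2.
  have := sqr_ge0 (coords (f u)).2; rewrite !expr2 => h1 h2 h3.
  by split; [split|]; apply: H; lra.
have [m [mr mC]] := compact_bounded cC.
have m1 : m < `|m| + 1 by have := ler_norm m; lra.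
have {}mC := mC _ m1.
(* In the compact set each of the three coordinates is at most |m| + 1 in absolute value. *)
apply: filterS (cf (3 * (`|m| + 1) ^+ 2)) => u lt; apply: CU; left.
exists (coords (f u)) => // /mC /= le; move: lt; apply/negP; rewrite -leNgt.
have sq (k : R) : `|k| <= `|m| + 1 -> k * k <= (`|m| + 1) ^+ 2.
  move=> km; rewrite -expr2 -real_normK ?num_real //.
  by rewrite lerXn2r ?nnegrE ?addr_ge0.
rewrite sqn_coords.
have [h12 h3] : `|(coords (f u)).1| <= `|m| + 1 /\
    `|(coords (f u)).2| <= `|m| + 1.
  by move: le; rewrite {1}/Num.norm /= ge_max => /andP[].
have [h1 h2] : `|(coords (f u)).1.1| <= `|m| + 1 /\
    `|(coords (f u)).1.2| <= `|m| + 1.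
  by move: h12; rewrite {1}/Num.norm /= ge_max => /andP[].
by have := sq _ h1; have := sq _ h2; have := sq _ h3; lra.
Qed.

(** Stated through [sqn] to match [inH_cvg_none]: the inversion below replaces [sqn] by its inverse
    and so exchanges the two criteria. *)
Lemma inH_cvg0 f :
  coords (f u) @[u --> F] --> (0 : R, 0 : R, 0 : R) <->
  forall e, 0 < e -> \forall u \near F, sqn (f u) < e.
Proof.
split=> [cf e e0|cf].
  pose sv (v : R * R * R) := v.1.1 * v.1.1 + v.1.2 * v.1.2 + v.2 * v.2.
  have [csv] : is_cont sv by rewrite /sv; cont_poly.
  have c0 := cvg_comp _ _ cf (csv (0, 0, 0)).
  have e1 : sv (0, 0, 0) < e by rewrite /sv /= !mulr0 !addr0.
  have c1 : F [set u | sv (coords (f u)) < e].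
    by have /cvgr_lt /(_ _ e1) := c0.
  by apply: filterS c1 => u; rewrite /= sqn_coords.
have C (h : R * R * R -> R) : (forall q, h (coords q) ^+ 2 <= sqn q) ->
    h (coords (f u)) @[u --> F] --> (0 : R).
  move=> hle; apply/cvgr0Pnorm_lt => e e0.
  apply: filterS (cf _ (exprn_gt0 2 e0)) => u lt.
  have lt' := le_lt_trans (hle (f u)) lt.
  rewrite -[X in X < _]/(Num.Def.normr (h (coords (f u)))) ltr_norml.
  by apply/andP; split; nra.
have s1 q : (coords q).1.1 ^+ 2 <= sqn q.
  by rewrite sqn_coords -!expr2 -addrA lerDl addr_ge0 ?sqr_ge0.
have s2 q : (coords q).1.2 ^+ 2 <= sqn q.
  by rewrite sqn_coords -!expr2 addrAC lerDr addr_ge0 ?sqr_ge0.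
have s3 q : (coords q).2 ^+ 2 <= sqn q.
  by rewrite sqn_coords -!expr2 lerDr addr_ge0 ?sqr_ge0.
have c1 := C (fun v => v.1.1) s1; have c2 := C (fun v => v.1.2) s2.
have c3 := C (fun v => v.2) s3.
exact: (cvg_pair (cvg_pair c1 c2) c3).
Qed.
Lemma act_inH_cvg_regular M f (z : R[i]) : SL2 M ->
  M ord_max ord0 * z + M ord_max ord_max != 0 ->
  inH (f u) @[u --> F] --> bd (Some z) ->
  inH (act M (f u)) @[u --> F] --> bd (mob M (Some z)).
Proof.
move=> dM n0 /= /inH_cvg_some cf.
rewrite (negbTE n0) /=; apply/inH_cvg_some.
have -> : (fun u => coords (act M (f u))) = act_fun M \o (fun u => coords (f u)).
  by apply/funext => u /=; rewrite coords_act.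
set v0 := (_, _, _) in cf.
have zE : v0.1.1 +i* v0.1.2 = z by rewrite /v0 /=; case: (z).
have v02 : v0.2 ^+ 2 = 0 by rewrite expr0n.
have dE : (den_fun M v0)%:C = (M ord_max ord0 * z + M ord_max ord_max) *
    (M ord_max ord0 * z + M ord_max ord_max)^*.
  by rewrite /den_fun zE v02 mulr0 addr0 sqr_normcC.
have d0 : den_fun M v0 != 0.
  rewrite -(inj_eq (@complexI R)) dE mulf_neq0 // conjc_eq0 //.
have -> : (complex.Re ((M ord0 ord0 * z + M ord0 ord_max) /
    (M ord_max ord0 * z + M ord_max ord_max)),
   complex.Im ((M ord0 ord0 * z + M ord0 ord_max) /
    (M ord_max ord0 * z + M ord_max ord_max)), 0) = act_fun M v0.
  rewrite /act_fun /num_fun zE v02 rmorph0 mulr0 addr0 mul0r.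
  set P := M ord0 ord0 * z + _; set Q := _ + _ in n0 dE *.
  have cQ0 : Q^* != 0 by rewrite conjc_eq0.
  have -> : P / Q = (P * Q^*) / (den_fun M v0)%:C.
    by rewrite dE; field; rewrite n0 cQ0.
  by rewrite divc_real.
exact: cvg_comp cf (act_fun_cvg d0).
Qed.

End Limits.

(* The inversion z |-> -1/z exchanges 0 and infinity, which reduces the pole of a
   Moebius map and the point at infinity to the case of a finite regular point. *)
Definition mxinv : 'M[R[i]]_2 := mx2 0 (-1) 1 0.

Lemma mx2E a b c d : ((mx2 a b c d : 'M[R[i]]_2) ord0 ord0 = a) *
  (mx2 a b c d ord0 ord_max = b) * (mx2 a b c d ord_max ord0 = c) *
  (mx2 a b c d ord_max ord_max = d).
Proof. by rewrite !mxE. Qed.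

Lemma SL2_mxinv : SL2 mxinv.
Proof. by rewrite /SL2 /mxinv det_mx2 mul0r mulr1 sub0r opprK. Qed.

Lemma mxinv_sq : mxinv * mxinv = -1.
Proof.
rewrite -[LHS]/(mxinv *m mxinv) mul_mx2 mx2_1 opp_mx2.
by rewrite !(mul0r, mulr0, mul1r, mulr1, add0r, addr0, oppr0).
Qed.

Lemma act_mxinvK q : act mxinv (act mxinv q) = q.
Proof.
rewrite -actM ?mxinv_sq ?actN ?act1 //; exact: SL2_1 || exact: SL2_mxinv.
Qed.

Lemma act_mxinvE M q : SL2 M -> act mxinv (act (mxinv * M) q) = act M q.
Proof. by move=> dM; rewrite actM ?act_mxinvK //; exact: SL2_mxinv. Qed.

Lemma sqn_gt0 q : 0 < sqn q.
Proof. by rewrite ltr_wpDl ?sqr_ge0 // exprn_gt0 ?ht_gt0. Qed.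

Lemma sqn_mxinv q : sqn (act mxinv q) = (sqn q)^-1.
Proof.
have s0 := sqn_gt0 q.
have dq : act_den mxinv q = sqn q.
  by rewrite /act_den !mx2E mul1r addr0 normc1 expr1n mul1r.
have hq : hz (act mxinv q) = (- (hz q)^*) / (sqn q)%:C.
  rewrite hz_act ?dq; last exact: SL2_mxinv.
  by rewrite !mx2E !mul0r !add0r mul1r addr0 addr0 mulN1r.
rewrite {1}/sqn ht_act ?dq; last exact: SL2_mxinv.
rewrite sqr_normcE hq divc_real /=.
have -> : sqn q = complex.Re (hz q) ^+ 2 + complex.Im (hz q) ^+ 2 + ht q ^+ 2.
  by rewrite /sqn sqr_normcE.
move: s0; rewrite /sqn sqr_normcE => s0.
case: (hz q) s0 => a b /= s0.
by field; rewrite gt_eqF.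
Qed.

Lemma SL2_pole M (z : R[i]) : SL2 M ->
  M ord_max ord0 * z + M ord_max ord_max = 0 ->
  M ord0 ord0 * z + M ord0 ord_max != 0.
Proof.
move=> /SL2E dM e; apply/eqP => e'; have /eqP := @oner_eq0 R[i]; apply.
rewrite -dM.
transitivity (M ord0 ord0 * (M ord_max ord0 * z + M ord_max ord_max) -
  M ord_max ord0 * (M ord0 ord0 * z + M ord0 ord_max)); first by ring.
by rewrite e e' !mulr0 subrr.
Qed.

Section Limits2.
Context {T : Type} (F : set_system T) {FF : Filter F}.
Implicit Types f : T -> H3 R.

Lemma mxinv_cvg_none f : inH (f u) @[u --> F] --> bd (Some (0 : R[i])) ->
  inH (act mxinv (f u)) @[u --> F] --> bd (None : Chat R).
Proof.
move=> /inH_cvg_some/inH_cvg0 cf; apply/inH_cvg_none => r.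
have r0 : 0 < (`|r| + 1)^-1 by rewrite invr_gt0 ltr_wpDl.
apply: filterS (cf _ r0) => u; rewrite sqn_mxinv => lt.
apply: (@lt_le_trans _ _ (`|r| + 1)); first by have := ler_norm r; lra.
by rewrite -[leLHS]invrK lef_pV2 ?posrE ?sqn_gt0 // ltW.
Qed.

Lemma mxinv_cvg_zero f : inH (f u) @[u --> F] --> bd (None : Chat R) ->
  inH (act mxinv (f u)) @[u --> F] --> bd (Some (0 : R[i])).
Proof.
move=> /inH_cvg_none cf; apply/inH_cvg_some/inH_cvg0 => e e0.
apply: filterS (cf e^-1) => u lt; rewrite sqn_mxinv.
by rewrite -[ltRHS]invrK ltf_pV2 ?posrE ?sqn_gt0 // invr_gt0.
Qed.

Lemma act_inH_cvg_some M f (z : R[i]) : SL2 M ->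
  inH (f u) @[u --> F] --> bd (Some z) ->
  inH (act M (f u)) @[u --> F] --> bd (mob M (Some z)).
Proof.
move=> dM cf.
have [e|] := eqVneq (M ord_max ord0 * z + M ord_max ord_max) 0; last first.
  by move=> n0; exact: act_inH_cvg_regular.
have -> : mob M (Some z) = None by rewrite /= e eqxx.
have n0 : M ord0 ord0 * z + M ord0 ord_max != 0.
  apply: (@SL2_pole M z) => //.
(* At a pole z of M, [mxinv * M] is regular and sends z to 0; a second inversion sends 0 to
   infinity. *)
have dI := SL2M SL2_mxinv dM.
have IM : mxinv * M = mx2 (- M ord_max ord0) (- M ord_max ord_max)
                          (M ord0 ord0) (M ord0 ord_max).
  rewrite -[LHS]/(mxinv *m M) {1}(mx2P M) mul_mx2.
  by rewrite !(mul0r, mulN1r, mul1r, add0r, addr0).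
have -> : (fun u => inH (act M (f u))) =
    (fun u => inH (act mxinv (act (mxinv * M) (f u)))).
  by apply/funext => u; rewrite act_mxinvE.
apply: mxinv_cvg_none.
have -> : Some (0 : R[i]) = mob (mxinv * M) (Some z).
  by rewrite IM /= !mx2E (negbTE n0) !mulNr -opprD e oppr0 mul0r.
by apply: act_inH_cvg_regular => //; rewrite IM !mx2E.
Qed.

Lemma act_inH_cvg M f xi : SL2 M -> inH (f u) @[u --> F] --> bd xi ->
  inH (act M (f u)) @[u --> F] --> bd (mob M xi).
Proof.
case: xi => [z|] dM cf; first exact: act_inH_cvg_some.
(* [mxinv] squares to -1, so M = (- M * mxinv) * mxinv, where the inner inversion moves infinity to
   0. *)
have dI := SL2M (SL2N dM) SL2_mxinv.
have MI : - M * mxinv = mx2 (- M ord0 ord_max) (M ord0 ord0)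
                          (- M ord_max ord_max) (M ord_max ord0).
  rewrite -[LHS]/(- M *m mxinv) {1}(mx2P M) opp_mx2 mul_mx2.
  by rewrite !(mulr0, mulrN1, mulr1, add0r, addr0, opprK).
have -> : (fun u => inH (act M (f u))) =
    (fun u => inH (act (- M * mxinv) (act mxinv (f u)))).
  apply/funext => u; rewrite actM ?act_mxinvK ?actN //; first exact: SL2N.
  exact: SL2_mxinv.
have -> : mob M None = mob (- M * mxinv) (Some 0).
  by rewrite MI /= !mx2E !mulr0 !add0r.
by apply: act_inH_cvg_some => //; exact: mxinv_cvg_zero.
Qed.

End Limits2.

(* Homogeneous coordinates; the junk pair (0, 0) also gives infinity. *)
Definition hom (u v : R[i]) : Chat R := if v == 0 then None else Some (u / v).

Lemma mob_hom M u v : (u != 0) || (v != 0) -> mob M (hom u v) =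
  hom (M ord0 ord0 * u + M ord0 ord_max * v)
      (M ord_max ord0 * u + M ord_max ord_max * v).
Proof.
rewrite /hom; have [-> /=|v0 _] := eqVneq v 0.
  rewrite orbF => u0; rewrite !mulr0 !addr0 mulf_eq0 (negbTE u0) orbF.
  have [//|c0] := eqVneq (M ord_max ord0) 0.
  by congr Some; field; rewrite u0 c0.
have e : M ord_max ord0 * (u / v) + M ord_max ord_max =
    (M ord_max ord0 * u + M ord_max ord_max * v) / v by field; rewrite v0.
rewrite /= e mulf_eq0 invr_eq0 (negbTE v0) orbF.
have [//|n0] := eqVneq (M ord_max ord0 * u + M ord_max ord_max * v) 0.
by congr Some; field; rewrite v0 n0.
Qed.

Lemma hom_surj xi : exists u v, [/\ (u != 0) || (v != 0) & xi = hom u v].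
Proof.
case: xi => [z|]; last by exists 1, 0; rewrite oner_eq0 /hom eqxx.
by exists z, 1; rewrite oner_eq0 orbT /hom oner_eq0 divr1.
Qed.

Lemma mobM M N xi : SL2 N -> mob (M * N) xi = mob M (mob N xi).
Proof.
move=> /SL2E dN; have [u [v [uv ->]]] := hom_surj xi.
rewrite -[M * N]/(M *m N) !mob_hom //; last first.
  (* The image pair is not (0, 0): Cramer's rule recovers (u, v) from it. *)
  rewrite -negb_and; apply/negP => /andP[/eqP e1 /eqP e2].
  have eu : u = N ord_max ord_max * (N ord0 ord0 * u + N ord0 ord_max * v)
      - N ord0 ord_max * (N ord_max ord0 * u + N ord_max ord_max * v).
    by rewrite -[LHS]mul1r -dN; ring.
  have ev : v = N ord0 ord0 * (N ord_max ord0 * u + N ord_max ord_max * v)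
      - N ord_max ord0 * (N ord0 ord0 * u + N ord0 ord_max * v).
    by rewrite -[LHS]mul1r -dN; ring.
  by rewrite e1 e2 !mulr0 subrr in eu ev; rewrite eu ev eqxx in uv.
have := mul_mx2 (M ord0 ord0) (M ord0 ord_max) (M ord_max ord0) (M ord_max ord_max)
  (N ord0 ord0) (N ord0 ord_max) (N ord_max ord0) (N ord_max ord_max).
rewrite -!mx2P => ->; rewrite !mx2E.
by congr hom; ring.
Qed.

End Boundary.

(** * Invariance of the core and of the strips *)

Section Invariance.
Variable R : realType.
Implicit Types (V W X : 'M[R[i]]_2) (G : set 'M[R[i]]_2) (q x y : H3 R).

(** Only one inclusion; the other one is the same property of V^-1. *)
Definition normalizes V G : Prop := forall X, G X -> G (V * X * V^-1).

Lemma act_conj V X q : SL2 V -> SL2 X ->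
  act (V * X * V^-1) (act V q) = act V (act X q).
Proof.
move=> dV dX; rewrite actM ?actVK ?actM //; first exact: SL2M.
exact: SL2V.
Qed.

Lemma limit_set_mob V G xi : SL2 V -> G `<=` @SL2 R -> normalizes V G ->
  limit_set G xi -> limit_set G (mob V xi).
Proof.
(* The base point moves along with V, because (V X V^-1) (V q) = V (X q). *)
move=> dV GS nV [q [X [GX cX]]]; exists (act V q), (fun n => V * X n * V^-1).
split=> [n|]; first exact: nV.
have -> : (fun n => inH (act (V * X n * V^-1) (act V q))) =
    (fun n => inH (act V (act (X n) q))).
  by apply/funext => n; rewrite act_conj //; exact: GS.
exact: act_inH_cvg.
Qed.

Lemma line_from_to_act V g xi eta : SL2 V -> line_from_to g xi eta ->
  line_from_to (act V \o g) (mob V xi) (mob V eta).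
Proof.
move=> dV [gg gx ge]; split; [|exact: act_inH_cvg|exact: act_inH_cvg].
by move=> u v; rewrite /= hdist_act.
Qed.

Lemma core_act V G : SL2 V -> G `<=` @SL2 R -> normalizes V G ->
  forall q, core G q -> core G (act V q).
Proof.
(* The hull is an intersection, so q is tested against the preimage of K under V, which is again
   convex and contains the required lines. *)
move=> dV GS nV q Cq K cK lK; apply: (Cq [set x | K (act V x)]).
  move=> x y z Kx Ky e; apply: (cK _ _ _ Kx Ky).
  by rewrite !hdist_act.
move=> g xi eta lg Lx Le _ [t _ <-].
have lVg := line_from_to_act dV lg.
apply: (lK _ _ _ lVg (limit_set_mob dV GS nV Lx) (limit_set_mob dV GS nV Le)).
by exists t.
Qed.

Lemma axis_act V W q : SL2 V -> SL2 W -> V * W = W * V ->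
  axis W q -> axis W (act V q).
Proof.
move=> dV dW VW [g [xi [eta [lg fx fe [t _ <-]]]]].
exists (act V \o g), (mob V xi), (mob V eta).
by split; [exact: line_from_to_act|rewrite -mobM // -VW mobM // fx
  |rewrite -mobM // -VW mobM // fe|exists t].
Qed.

Lemma commute_inv V W : SL2 V -> V * W = W * V -> V^-1 * W = W * V^-1.
Proof.
move=> dV VW; apply: (mulrI (SL2_unit dV)).
by rewrite mulrA mulrV ?SL2_unit // mul1r mulrA VW -mulrA mulrV ?SL2_unit // mulr1.
Qed.

Lemma hdist_axis_act V W q : SL2 V -> SL2 W -> V * W = W * V ->
  hdist_set (act V q) (axis W) = hdist_set q (axis W).
Proof.
move=> dV dW VW; have dV' := SL2V dV; have VW' := commute_inv dV VW.
rewrite /hdist_set; congr inf; apply/seteqP; split=> _ [y Wy <-].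
  exists (act V^-1 y); first exact: axis_act.
  by rewrite -(hdist_act _ _ dV) actKV.
by exists (act V y); [exact: axis_act|rewrite hdist_act].
Qed.

Lemma Equi_cut_act V W s q : SL2 V -> SL2 W -> presJ V -> V * W = W * V ->
  Equi_cut W s q -> Equi_cut W s (act V q).
Proof.
move=> dV dW JV VW [Eq nq]; split.
  by rewrite /Equi /= hdist_axis_act.
have dV' := SL2V dV; have JV' := presJV dV JV.
have P : forall x, @plane R x -> @plane R (act V^-1 x).
  by move=> x; exact: plane_act.
by case=> /(push_act dV' JV' P); rewrite actVK // => pq; apply: nq; [left|right].
Qed.

Lemma Rec_act G V W s q : SL2 V -> SL2 W -> presJ V -> V * W = W * V ->
  (forall y, core G y -> core G (act V^-1 y)) ->
  Rec G W s q -> Rec G W s (act V q).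
Proof.
move=> dV dW JV VW CV [Eq Cq]; split; first exact: Equi_cut_act.
have dV' := SL2V dV; have JV' := presJV dV JV; have VW' := commute_inv dV VW.
(* A connected set that joins V q to the core is pulled back by V^-1 to one that joins q to the
   core, against [Cq]. *)
apply/seteqP; split=> // c [[C [Cq' CE cC] Cy] [y Gy e]].
suff : set0 (coords (act V^-1 y)) by [].
rewrite -Cq; split; last by exists (act V^-1 y) => //; exact: CV.
have fV x : act_fun V^-1 (coords x) = coords (act V^-1 x) by rewrite coords_act.
exists (act_fun V^-1 @` C); last by exists c; rewrite // -e fV.
split.
- by exists (coords (act V q)) => //; rewrite fV actVK.
- move=> _ [d /CE[x Ex <-] <-]; rewrite fV; exists (act V^-1 x) => //.
  exact: Equi_cut_act.
- apply: connected_continuous_connected => //.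
  apply: continuous_in_subspaceT => d /set_mem/CE[x _ <-].
  apply: act_fun_cvg; rewrite den_fun_coords.
  by rewrite gt_eqF // act_den_gt0.
Qed.

(** * Conjugation of generators and commutators, up to sign *)

Lemma pmeq_presJ V W : pmeq V W -> presJ W -> presJ V.
Proof. by case=> -> // JW; exact: presJN. Qed.

Lemma pmeq_sq_inv V : SL2 V -> pmeq (V * V) 1 -> pmeq V^-1 V.
Proof.
move=> /SL2_unit uV [] e; [left|right]; apply: (mulrI uV); rewrite mulrV ?e //.
by rewrite mulrN e opprK.
Qed.

(** V (V W) V^-1 = V^2 W V^-1, where V^2 is a sign and W is its own inverse up to sign. *)
Lemma involutions_conj_inv V W X : SL2 V -> SL2 W ->
  pmeq (V * V) 1 -> pmeq (W * W) 1 -> pmeq X (V * W) -> pmeq (V * X * V^-1) X^-1.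
Proof.
move=> dV dW sV sW eX.
have uV := SL2_unit dV; have uW := SL2_unit dW.
have iW := pmeq_sq_inv dW sW.
suff : pmeq (V * (V * W) * V^-1) (V * W)^-1.
  by case: eX => ->; rewrite ?invrN ?mulrN ?mulNr // => -[->|->]; [left|right].
rewrite invrM // mulrA.
by case: sV iW => -> [] ->; rewrite ?(mulNr, mul1r);
  [left|right; rewrite opprK|right|left].
Qed.

Definition signed_closed G : Prop := forall X Y, pmeq X Y -> G Y -> G X.

Lemma PSL2_signed_closed G : PSL2_subgroup G -> signed_closed G.
Proof.
case=> _ _ GN GM _ X Y [->//|-> GY]; rewrite -mulN1r; exact: GM.
Qed.

Lemma normalizes_generators G V A B : PSL2_subgroup G -> SL2 V ->
  generators G A B -> G (V * A * V^-1) -> G (V * B * V^-1) -> normalizes V G.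
Proof.
move=> sG dV [GA GB gG] cA cB X GX; have [w ew] := gG X GX.
have uV := SL2_unit dV; have gc := PSL2_signed_closed sG.
have [GS G1 _ GM GV] := sG.
have cI Y : G Y -> G (V * Y * V^-1) -> G (V * Y^-1 * V^-1).
  move=> /GS/SL2_unit uY /GV; rewrite !invrM ?unitrV ?unitrMl //.
  by rewrite invrK mulrA.
have {ew} : pmeq (V * X * V^-1) (V * weval A B w * V^-1).
  by case: ew => ->; [left|right; rewrite mulrN mulNr].
move=> e; apply: (gc _ _ e); rewrite /weval {e}.
elim: w => [|l w IH]; first by rewrite big_nil mulr1 mulrV.
rewrite big_cons.
rewrite -[X in V * X * _]/(_ * _); set Z := (X in V * (X * _) * _).
set P := (X in V * (_ * X) * _).
have -> : V * (Z * P) * V^-1 = (V * Z * V^-1) * (V * P * V^-1).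
  by rewrite !mulrA mulrVK.
apply: GM => //; rewrite {}/Z {P IH}.
by case: l => -[] []; [exact: cI GB cB|exact: cB|exact: cI GA cA|exact: cA].
Qed.

Lemma normalizesM G V W : SL2 V -> SL2 W ->
  normalizes V G -> normalizes W G -> normalizes (V * W) G.
Proof.
move=> /SL2_unit uV /SL2_unit uW nV nW X /nW/nV.
by rewrite invrM // !mulrA.
Qed.

Lemma normalizes_mem G V : PSL2_subgroup G -> G V -> normalizes V G.
Proof. by case=> _ _ _ GM GV gV X GX; apply: (GM) (GM _ _ gV GX) (GV _ gV). Qed.

Lemma normalizes_pmeq G V W : pmeq V W -> normalizes W G -> normalizes V G.
Proof. by case=> -> // nW X /nW; rewrite invrN mulrN !mulNr opprK. Qed.

Lemma comm2_conj V X Y : SL2 V -> SL2 X -> SL2 Y ->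
  V * comm2 X Y * V^-1 = comm2 (V * X * V^-1) (V * Y * V^-1).
Proof.
move=> /SL2_unit uV /SL2_unit uX /SL2_unit uY; rewrite /comm2.
by rewrite !invrM ?unitrV ?unitrMl // !invrK !mulrA !mulrVK.
Qed.

(** Each argument occurs once with its inverse, so the signs cancel. The result is an equality of
    matrices, which later gives exact commutation. *)
Lemma comm2_pmeq X Y X' Y' : pmeq X X' -> pmeq Y Y' -> comm2 X Y = comm2 X' Y'.
Proof.
by rewrite /comm2; case=> ->; case=> ->; rewrite ?invrN ?(mulrN, mulNr, opprK).
Qed.

Lemma comm2V_conj X Y : SL2 X -> SL2 Y ->
  (Y * X) * comm2 X^-1 Y^-1 * (Y * X)^-1 = comm2 X Y.
Proof.
move=> /SL2_unit uX /SL2_unit uY; rewrite /comm2 !invrK invrM // !mulrA.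
by rewrite mulrK // divrr // mul1r.
Qed.

(** * Orbits and the induced map of the quotient *)

Lemma quot_inj G (O O' : quot G) : sval O = sval O' -> O = O'.
Proof.
case: O O' => [a pa] [b pb] /= e; subst b.
by congr exist; exact: Prop_irrelevance.
Qed.

Lemma orbitG_act G X q : PSL2_subgroup G -> G X ->
  orbitG G (act X q) = orbitG G q.
Proof.
case=> GS _ _ GM GV GX; apply/seteqP; split=> _ [Y GY <-].
  by exists (Y * X); [exact: GM|rewrite actM //; exact: GS].
exists (Y * X^-1); first by apply: GM => //; exact: GV.
have dX := GS _ GX; rewrite actM ?actVK //; first exact: GS.
exact: SL2V.
Qed.

Lemma image_orbitG G V q : G `<=` @SL2 R -> SL2 V ->
  normalizes V G -> normalizes V^-1 G ->
  act V @` orbitG G q = orbitG G (act V q).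
Proof.
move=> GS dV nV nV'; apply/seteqP; split.
  move=> _ [_ [X GX <-] <-]; exists (V * X * V^-1); first exact: nV.
  by rewrite act_conj //; exact: GS.
move=> _ [X GX <-]; have GX' := nV' _ GX; rewrite invrK in GX'.
exists (act (V^-1 * X * V) q); first by exists (V^-1 * X * V).
rewrite -act_conj //; last exact: GS.
by rewrite !mulrA mulrV ?SL2_unit // mul1r mulrK ?SL2_unit.
Qed.

End Invariance.

Section Surface.
Variable R : realType.
Implicit Types (V W X : 'M[R[i]]_2) (G : set 'M[R[i]]_2) (q x y : H3 R).

Lemma proj_act G X q : PSL2_subgroup G -> G X ->
  Defs.proj G (act X q) = Defs.proj G q.
Proof. by move=> sG GX; apply: quot_inj; exact: orbitG_act. Qed.

Lemma orbit_image_ex G V (GS : G `<=` @SL2 R) (dV : SL2 V)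
    (nV : normalizes V G) (nV' : normalizes V^-1 G) (O : quot G) :
  exists q, act V @` sval O = orbitG G q.
Proof. by have [q ->] := svalP O; exists (act V q); exact: image_orbitG. Qed.

(** Taking the image of the whole orbit avoids a choice of representatives; it is again an orbit
    because V normalizes G in both directions. *)
Lemma quot_map G V : G `<=` @SL2 R -> SL2 V -> normalizes V G ->
  normalizes V^-1 G -> exists j : quot G -> quot G,
    (forall O, sval (j O) = act V @` sval O) /\ induces V j.
Proof.
move=> GS dV nV nV'.
exists (fun O => exist _ (act V @` sval O) (orbit_image_ex GS dV nV nV' O)).
by split=> // q; apply: quot_inj; exact: image_orbitG.
Qed.

End Surface.

Theorem proposition11p1 (R : realType) (G : set 'M[R[i]]_2)
    (A B : 'M[R[i]]_2) (p pA pB : H3 R) (Hp HA HB : 'M[R[i]]_2)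
    (hG : Fuchsian G) (hfree : free_rank2 G)
    (hpar : forall X, G X -> ~ parabolic X)
    (hstop : stopping G A B p pA pB Hp HA HB) :
  exists2 j : quot G -> quot G, hyperelliptic Hp HA HB j &
    forall s : R, 0 < s -> j @` surface G A B s = surface G A B s.
Proof.
have [sG _ _] := hG; have [GS G1 _ GM GV] := sG.
have [gAB _ [htp htA htB] [eA eB] _] := hstop; have [GA GB _] := gAB.
have [dK _ _ K2] := htp; have [dHA _ _ _] := htA; have [dHB _ _ _] := htB.
have [dA dB] := (GS _ GA, GS _ GB).
have Ksq := half_turn_sq htp; have HAsq := half_turn_sq htA.
have HBsq := half_turn_sq htB.
have JK := half_turn_presJ htp.
have JA : presJ A.
  apply: (pmeq_presJ eA); apply: presJM => //; exact: half_turn_presJ htA.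
have JB : presJ B.
  apply: (pmeq_presJ eB); apply: presJM => //; exact: half_turn_presJ htB.
have cA := involutions_conj_inv dK dHA Ksq HAsq eA.
have cB := involutions_conj_inv dK dHB Ksq HBsq eB.
have gc := PSL2_signed_closed sG.
have nK : normalizes Hp G.
  apply: (normalizes_generators sG dK gAB).
    exact: gc cA (GV _ GA).
  exact: gc cB (GV _ GB).
have nK' : normalizes Hp^-1 G := normalizes_pmeq (pmeq_sq_inv dK Ksq) nK.
have dK' := SL2V dK.
have actKK q : act Hp (act Hp q) = q by have := congr1 (@^~ q) K2.
have [j [jE ij]] := quot_map GS dK nK nK'.
have jj : j \o j = id.
  apply/funext => O /=; apply: quot_inj; rewrite !jE.
  apply/seteqP; split=> [_ [_ [q Oq <-] <-]|q Oq]; first by rewrite actKK.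
  by exists (act Hp q); [exists q|rewrite actKK].
(* As V = [Hp] squares to 1 on points, H acts as V X, which is (V X V^-1) V with V X V^-1 in G. *)
have ind X H : G X -> SL2 H -> pmeq X (Hp * H) -> induces H j.
  move=> GX dH eX q; rewrite ij.
  have -> : act H q = act Hp (act X q).
    by rewrite (act_pmeq _ (GS _ GX) eX) actM // actKK.
  by rewrite -(act_conj q dK (GS _ GX)) (proj_act _ sG (nK _ GX)).
exists j.
  split=> //; [exact: ind GA dHA eA|exact: ind GB dHB eB|].
  move=> O O'; rewrite /qdist; congr inf; apply/seteqP; split=> r [x [y []]].
    rewrite !jE => -[x' Ox <-] [y' Oy <-] ->; exists x', y'; split => //.
    by rewrite hdist_act.
  move=> Ox Oy ->; exists (act Hp x), (act Hp y); rewrite !jE hdist_act //.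
move=> s s0.
(* [Hp] conjugates [B, A] to [B^-1, A^-1], and [A B] conjugates the latter back,
   so [V] acts on the quotient as [Hp] does and commutes with [B, A]. *)
set W := comm2 B A; set V := A * B * Hp.
have GAB : G (A * B) by exact: GM.
have dV : SL2 V by apply: SL2M => //; exact: GS.
have GW : G W := GM _ _ (GM _ _ (GM _ _ GB GA) (GV _ GB)) (GV _ GA).
have dW := GS _ GW.
have JV : presJ V by apply: presJM => //; exact: presJM.
have VW : V * W = W * V.
  have e : V * W * V^-1 = W.
    have dAB := GS _ GAB.
    transitivity (A * B * (Hp * W * Hp^-1) * (A * B)^-1).
      by rewrite /V invrM ?SL2_unit // !mulrA.
    by rewrite /W comm2_conj // (comm2_pmeq cB cA) comm2V_conj.
  by rewrite -{2}e mulrVK ?SL2_unit.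
have nAB := normalizes_mem sG GAB.
have nAB' := normalizes_mem sG (GV _ GAB).
(* V^-1 is [Hp^-1] times an element of G, and both factors normalize G. *)
have coreV' y : core G y -> core G (act V^-1 y).
  apply: core_act => //; first exact: SL2V.
  rewrite /V invrM ?SL2_unit //; last exact: GS.
  by apply: normalizesM => //; apply: SL2V; exact: GS.
have coreK y : core G y -> core G (act Hp y) by exact: core_act.
(* One inclusion is enough, because j is an involution. *)
have jsub O : surface G A B s O -> surface G A B s (j O).
  case=> [ [ [q pq <-] | [q pq <-] ] | [q Rq <-] ]; rewrite ij.
  - by left; left; exists (act Hp q) => //; exact: push_act.
  - by left; right; exists (act Hp q) => //; exact: push_act.
  - right; exists (act V q); first exact: Rec_act.
    by rewrite /V actM ?(proj_act _ sG GAB) //; exact: GS.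
apply/seteqP; split=> [_ [x Sx <-]|x Sx]; first exact: jsub.
by exists (j x); [exact: jsub|rewrite -[RHS]/(id x) -jj].
Qed.
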